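(* For every sufficiently small $\eta>0$ there exists a constant $C'$ such that for all positive integers $n$, $$|Forb(n,T_5,\eta)| < (1+C'2^{-n/10})\,S(n).$$
   Context: A 3-graph on $[n]$ is a set of 3-element subsets of $[n]$. $T_5$ is the 3-graph $\{123,124,125,345\}$. For an ordered partition $P=(X,Y)$ of the vertex set of a 3-graph $\mathcal{H}$, an edge is consistent with $P$ if it has exactly two vertices in $X$, and inconsistent otherwise. $D_{\mathcal{H}}$ is the minimum over all ordered partitions of the number of inconsistent edges. $Forb(n,T_5,\eta)=\{\mathcal{H}\subset\binom{[n]}{3}: T_5\not\subset\mathcal{H},\ D_{\mathcal{H}}\le \eta n^3\}$. A 3-graph is semi-bipartite if it has an ordered vertex partition $(X,Y)$ with every edge consistent (exactly two vertices in $X$). $S(n)$ is the number of semi-bipartite 3-graphs on vertex set $[n]$. *)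

(* Defs.v *)
From HB Require Import structures.
From mathcomp Require Import all_boot all_order all_algebra.
From mathcomp Require Import reals exp.

Set Implicit Arguments.
Unset Strict Implicit.
Unset Printing Implicit Defensive.

Import Order.TTheory GRing.Theory Num.Theory.

Local Open Scope ring_scope.

Definition is_3graph (V : finType) (H : {set {set V}}) : bool :=
  [forall e in H, #|e| == 3%N].

(* Containment as a not necessarily induced subgraph, up to relabelling. *)
Definition has_copy (V W : finType) (F : {set {set V}}) (H : {set {set W}})
    : bool :=
  [exists f : {ffun V -> W}, injectiveb f && [forall e in F, f @: e \in H]].

(* The element v of 'I_5 stands for the vertex v + 1 of {1, ..., 5}. *)
Definition T5_edge (i j k : nat) : {set 'I_5} :=
  [set v : 'I_5 | val v \in [:: i.-1; j.-1; k.-1]].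

Definition T5 : {set {set 'I_5}} :=
  [set T5_edge 1 2 3; T5_edge 1 2 4; T5_edge 1 2 5; T5_edge 3 4 5].

(* The parts may be empty. *)
Definition ordered_partition (V : finType) (P : {set V} * {set V}) : bool :=
  (P.1 :|: P.2 == [set: V]) && [disjoint P.1 & P.2].

Definition consistent (V : finType) (P : {set V} * {set V}) (e : {set V})
    : bool :=
  #|e :&: P.1| == 2%N.

Definition inconsistent_edges (V : finType) (H : {set {set V}})
    (P : {set V} * {set V}) : {set {set V}} :=
  [set e in H | ~~ consistent P e].

(* ([set: V], set0) is an ordered partition, so the minimum is attained. *)
Definition min_inconsistent (V : finType) (H : {set {set V}}) : nat :=
  #|inconsistent_edges H
      [arg min_(P < ([set: V], set0) | ordered_partition P)
         #|inconsistent_edges H P|]|.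

Definition Forb_T5 (R : realType) (n : nat) (eta : R)
    : {set {set {set 'I_n}}} :=
  [set H : {set {set 'I_n}} |
    [&& is_3graph H, ~~ has_copy T5 H & (min_inconsistent H)%:R <= eta * n%:R ^+ 3]].

Definition semi_bipartite (V : finType) (H : {set {set V}}) : bool :=
  [exists P : {set V} * {set V},
     ordered_partition P && [forall e in H, consistent P e]].

Definition num_semi_bipartite (n : nat) : nat :=
  #|[set H : {set {set 'I_n}} | is_3graph H && semi_bipartite H]|.

(* Main.v *)
(* Fix an ordered partition (X, Y) and count the T5-free hypergraphs H for which
   it is optimal, at most eta n^3 triples are inconsistent, and at least one is.

   If |X| is not close to 2n/3, the number of consistent triples is smaller than
   the maximum by a cubic amount, which beats the choices of the inconsistent
   triples.  Otherwise call a vertex bad if its link, given the rest of H, lies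
   in a family smaller by a factor 2^(c n^2) than the family of all sets of
   consistent pairs.  Deleting bad vertices one at a time, either epsilon n of
   them are deleted and the cubic total gain again beats the choices of the
   inconsistent triples, or a hypergraph without bad vertices remains.

   T5-freeness and optimality show that without bad vertices every inconsistent
   triple is of the form abc with a in X and b, c in Y, and that ab and ac have
   few common neighbours in X.  Such a sparse pair costs a factor of about
   2^|X|, an inconsistent triple produces at least two of them, and
   2^(-2|X|), about 2^(-4n/3), leaves enough after summing over the 2^n
   partitions.  Finally a semi-bipartite count of at least 2^e is provided by
   the subsets of the e consistent triples of a best partition. *)
Require Import Defs.
From mathcomp Require Import all_boot all_order all_algebra.
From mathcomp Require Import reals exp.
From mathcomp Require Import zify.

Set Implicit Arguments.
Unset Strict Implicit.
Unset Printing Implicit Defensive.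

(** * Counting sets *)

(** The obstacle is that a bound on the total number of inconsistent triples leaves a few vertices,
    collected in [high], that may lie in quadratically many of them. So [same_side_bad] is used
    twice. In the first round only the vertices outside [high] are known to have small [bdeg]: in a
    rich link, the pairs on one side of the partition must meet [high] and so are few, while poor
    links are handled by optimality or by the absence of bad vertices. This yields a bound [th_z']
    on [bdeg] that is weaker than [th_z] but holds at every vertex. The second round then has no
    exceptional vertices and excludes the triples inside X or inside Y altogether.

    Optimality survives deletion only with an error of n pairs per deleted vertex, so the number K
    of deletions has to be a small multiple of n.

    To stay within natural numbers, a bound R / m on the ratio of a count A to 2 ^ e is written A *
    m <= R * 2 ^ e. *)

Lemma leq_card_bigcup (I T : finType) (P : pred I) (F : I -> {set T}) :
  #|\bigcup_(i | P i) F i| <= \sum_(i | P i) #|F i|.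
Proof.
elim/big_rec2: _ => [|i n A _ IH]; first by rewrite cards0.
by apply: leq_trans (leq_card_setU _ _) _; rewrite leq_add2l.
Qed.

Lemma leq_card_inj (S T : finType) (f : S -> T) (A : {set S}) (B : {set T}) :
  {in A &, injective f} -> (forall x, x \in A -> f x \in B) -> #|A| <= #|B|.
Proof.
move=> injf sAB; rewrite -(card_in_imset injf); apply: subset_leq_card.
by apply/subsetP => _ /imsetP[x xA ->]; apply: sAB.
Qed.

Lemma leq_card_fiber (S T : finType) (f : S -> T) (A : {set S}) (B : {set T})
    (k : nat) :
    (forall x, x \in A -> f x \in B) ->
    (forall y, y \in B -> #|[set x in A | f x == y]| <= k) ->
  #|A| <= #|B| * k.
Proof.
move=> fAB fib; rewrite -sum1_card (partition_big f (mem B)) //=.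
rewrite -sum_nat_const; apply: leq_sum => y yB; rewrite sum1dep_card.
by apply: leq_trans (fib y yB); rewrite subset_leq_card //; apply/subsetP => x;
  rewrite !inE.
Qed.

Definition binsum (N k : nat) : nat := \sum_(i < k.+1) 'C(N, i).

Lemma leq_binsum (N1 N2 k1 k2 : nat) :
  N1 <= N2 -> k1 <= k2 -> binsum N1 k1 <= binsum N2 k2.
Proof.
move=> leN lek; rewrite /binsum.
apply: (@leq_trans (\sum_(i < k1.+1) 'C(N2, i))).
  by apply: leq_sum => i _; rewrite leq_bin2l.
rewrite -(big_mkord xpredT (fun i => 'C(N2, i))).
rewrite -(big_mkord xpredT (fun i => 'C(N2, i))).
by rewrite [leqRHS](@big_cat_nat _ _ _ k1.+1) //= leq_addr.
Qed.

Lemma card_subsets_leq (T : finType) (A : {set T}) (k : nat) :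
  #|[set B : {set T} | (B \subset A) && (#|B| <= k)]| <= binsum #|A| k.
Proof.
have -> : [set B : {set T} | (B \subset A) && (#|B| <= k)] =
  \bigcup_(i < k.+1) [set B : {set T} | (B \subset A) && (#|B| == i)].
  apply/setP => B; rewrite inE; apply/idP/bigcupP.
    case/andP=> sBA leBk; have ltBk : #|B| < k.+1 by [].
    by exists (Ordinal ltBk); rewrite ?inE ?sBA /=.
  by case=> i _; rewrite inE => /andP[-> /eqP->]; rewrite -ltnS ltn_ord.
apply: leq_trans (leq_card_bigcup _ _) _.
by apply: leq_sum => i _; rewrite cards_draws.
Qed.

Lemma card_nearly_contained (T : finType) (O M : {set T}) (s : nat) :
  #|[set L : {set T} | (L \subset O) && (#|L :\: M| <= s)]|
    <= 2 ^ #|M| * binsum #|O :\: M| s.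
Proof.
rewrite -card_powerset; pose D := [set B : {set T} |
  (B \subset O :\: M) && (#|B| <= s)].
apply: (@leq_trans #|setX (powerset M) D|); last first.
  by rewrite cardsX leq_mul2l card_subsets_leq orbT.
apply: (@leq_card_inj _ _ (fun L => (L :&: M, L :\: M))).
  by move=> L1 L2 _ _ [e1 e2]; rewrite -(setID L1 M) -(setID L2 M) e1 e2.
move=> L; rewrite !inE /= => /andP[sLO ->]; rewrite subsetIr andbT /=.
exact: setSD.
Qed.

(* That is, (1 + 1/m)^k <= (m + 1) / (m + 1 - k). *)
Lemma expnS_leq (m k : nat) : k <= m ->
  m.+1 ^ k * (m.+1 - k) <= m ^ k * m.+1.
Proof.
elim: k => [|k IH] ltkm; first by rewrite subn0.
have {}IH := IH (ltnW ltkm).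
have mk : m.+1 * (m.+1 - k.+1) <= m * (m.+1 - k) by nia.
rewrite !expnSr; move: (m.+1 ^ k) (m ^ k) IH mk => a b.
set d := _ - k; set d' := _ - _.
move=> /(leq_mul (leqnn m)) le1 mk; have := leq_mul (leqnn a) mk; lia.
Qed.

(** After division by 2 ^ (t * (2 ^ t * j)), this is the j-th power of (1 + 1/m)^m <= 4 for m = 2 ^
    t. [expnS_leq] gives (1 + 1/m)^(m/2) <= 2, since m + 1 <= 2 (m + 1 - m/2). *)
Lemma exp2S_leq (t j : nat) : 0 < t ->
  (2 ^ t).+1 ^ (2 ^ t * j) <= 2 ^ (t * (2 ^ t * j) + 2 * j).
Proof.
move=> t0; set m := 2 ^ t.
have half : (m.+1) ^ (2 ^ t.-1) <= m ^ (2 ^ t.-1) * 2.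
  have mE : m = 2 ^ t.-1 * 2 by rewrite /m -{1}(prednK t0) expnS mulnC.
  have := @expnS_leq m (2 ^ t.-1) ltac:(lia).
  set a := m.+1 ^ _; set b := m ^ _ => le1.
  have p0 : 0 < 2 ^ t.-1 by rewrite expn_gt0.
  nia.
have tjE : 2 ^ t * j = 2 ^ t.-1 * (2 * j).
  by rewrite -{1}(prednK t0) expnS; lia.
rewrite expnD (expnM 2 t) -/m tjE (expnM m.+1) (expnM m) -expnMn.
by case: j tjE => [|j] _; rewrite ?muln0 // leq_exp2r.
Qed.

(** Exponential-moment bound with weight x = 2^(-t): the factor x^(i-k) is at least 1 for i <= k, so
    the sum is at most x^(-k) (1 + x)^N. Rounding N up to a multiple of 2 ^ t makes [exp2S_leq]
    applicable. *)
Lemma binsum_leq (N k t : nat) : 0 < t ->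
  binsum N k <= 2 ^ (t * k + 2 * (N %/ 2 ^ t).+1).
Proof.
move=> t0; set m := 2 ^ t; set j := (N %/ m).+1.
have m0 : 0 < m by rewrite expn_gt0.
have leN : N <= m * j by rewrite /j mulnC ltnW // ltn_ceil.
apply: leq_trans (leq_binsum leN (leqnn k)) _; move: (m * j) (exp2S_leq j t0).
rewrite -/m => N' le1.
have p0 : 0 < 2 ^ (t * N') by rewrite expn_gt0.
rewrite -(leq_pmul2l p0).
apply: (@leq_trans (2 ^ (t * k) * m.+1 ^ N')); last first.
  rewrite [2 ^ (t * k + _)]expnD mulnCA leq_mul2l -expnD.
  by apply/orP; right.
rewrite -[m.+1]addn1 expnDn /binsum big_distrr big_distrr /=.
apply: (@leq_trans (\sum_(i < k.+1) 2 ^ (t * k) * ('C(N', i) * m ^ (N' - i)))).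
  apply: leq_sum => i _; case: (leqP i N') => [iN|Ni]; last first.
    by rewrite bin_small // !mul0n !muln0.
  rewrite mulnC [leqRHS]mulnCA leq_mul2l -expnM -expnD leq_exp2l //.
  have := ltn_ord i; rewrite -mulnDr leq_mul2l; lia.
pose F i := 2 ^ (t * k) * ('C(N', i) * m ^ (N' - i)).
rewrite -(big_mkord xpredT F).
rewrite [leqRHS](_ : _ = \sum_(i < N'.+1) F i); last first.
  by apply: eq_bigr => i _; rewrite exp1n muln1.
rewrite -(big_mkord xpredT F).
case: (leqP k N') => kN.
  by rewrite [leqRHS](@big_cat_nat _ _ _ k.+1) //= leq_addr.
rewrite (@big_cat_nat _ _ _ N'.+1) //=; last exact: leqW.
rewrite [X in _ + X]big1_seq ?addn0 // => i; rewrite mem_index_iota => /andP[_ /andP[iN _]].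
by rewrite /F bin_small // mul0n muln0.
Qed.

(* Confining all but at most [s] members of a family of subsets of an [N]-set
   to a set with [r] fewer elements still saves a factor [2 ^ g]. *)
Definition net_gain (N g s r : nat) : bool := binsum N s * 2 ^ g <= 2 ^ r.

(** * Triples, links and [T5] *)

Lemma T5_edgeE (i j k : 'I_5) : T5_edge i.+1 j.+1 k.+1 = [set i; j; k].
Proof. by apply/setP => v; rewrite !inE orbA. Qed.

(** A copy of [T5] arises by sending 1, 2 to the pair [p] and 3, 4, 5 to a, b, c; the cardinalities
    of the edges supply the distinctness. *)
Lemma T5_freeF (W : finType) (H : {set {set W}}) (p : {set W}) (a b c : W) :
  is_3graph H -> ~~ has_copy T5 H ->
  a \notin p -> b \notin p -> c \notin p ->
  a |: p \in H -> b |: p \in H -> c |: p \in H -> [set a; b; c] \in H -> False.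
Proof.
move=> /forall_inP H3 /existsP nH ap bp cp aH bH cH abcH; apply: nH.
have := H3 _ aH; rewrite cardsU1 ap eqSS => /cards2P[u [v [uv pE]]].
have {H3} := H3 _ abcH; rewrite -setUA cardsU1 cards2 !inE => abc.
have [ab ac bc] : [/\ a != b, a != c & b != c].
  by move: abc; case: (a == b); case: (a == c); case: (b == c).
move: ap bp cp aH bH cH; rewrite pE !inE !negb_or.
move=> /andP[au av] /andP[bu bv] /andP[cu cv] aH bH cH.
pose s := [:: u; v; a; b; c].
have s_uniq : uniq s.
  rewrite /= !inE !negb_or uv ab ac bc.
  by rewrite ![u == _]eq_sym ![v == _]eq_sym au av bu bv cu cv.
exists [ffun i : 'I_5 => nth u s i]; apply/andP; split.
  apply/injectiveP => i j; rewrite !ffunE => /eqP.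
  by rewrite (nth_uniq u (s := s)) // => /eqP /val_inj.
apply/forall_inP => e.
have E (i j k : 'I_5) : [ffun i : 'I_5 => nth u s i] @: [set i; j; k] =
   [set nth u s i; nth u s j; nth u s k].
  by rewrite !imsetU !imset_set1 !ffunE.
rewrite !inE -!orbA => /or4P[] /eqP->.
- by rewrite (T5_edgeE ord0 (@Ordinal 5 1 isT) (@Ordinal 5 2 isT)) E /= setUC.
- by rewrite (T5_edgeE ord0 (@Ordinal 5 1 isT) (@Ordinal 5 3 isT)) E /= setUC.
- by rewrite (T5_edgeE ord0 (@Ordinal 5 1 isT) (@Ordinal 5 4 isT)) E /= setUC.
by rewrite (T5_edgeE (@Ordinal 5 2 isT) (@Ordinal 5 3 isT) (@Ordinal 5 4 isT)) E.
Qed.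

Section Links.

Variables (V : finType) (X : {set V}).
Implicit Types (H : {set {set V}}) (U S p e : {set V}) (v w x y : V).

Definition triples (U : {set V}) : {set {set V}} :=
  [set e : {set V} | (e \subset U) && (#|e| == 3)].

Definition ctriples (U : {set V}) : {set {set V}} :=
  [set e in triples U | #|e :&: X| == 2].

Definition link (H : {set {set V}}) (v : V) : {set {set V}} :=
  [set p : {set V} | (v \notin p) && (v |: p \in H)].

Definition delv (H : {set {set V}}) (v : V) : {set {set V}} :=
  [set e in H | v \notin e].

Lemma card_link (H : {set {set V}}) (v : V) : #|link H v| = #|[set e in H | v \in e]|.
Proof.
have -> : [set e in H | v \in e] = [set v |: p | p in link H v].
  apply/setP => e; rewrite !inE; apply/andP/imsetP => [[eH ve]|[p]].
    by exists (e :\ v); rewrite ?inE ?eqxx ?setD1K.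
  by rewrite inE => /andP[_ pH] ->; rewrite pH setU11.
rewrite card_in_imset // => p q; rewrite !inE => /andP[vp _] /andP[vq _] e.
by rewrite -(setU1K vp) e setU1K.
Qed.

Lemma card_delv_link (H : {set {set V}}) (v : V) : #|H| = #|delv H v| + #|link H v|.
Proof.
rewrite card_link -(cardsID [set e : {set V} | v \in e] H) addnC; congr (_ + _).
  by apply: eq_card => e; rewrite !inE andbC.
by apply: eq_card => e; rewrite !inE.
Qed.

Lemma linkS (H1 H2 : {set {set V}}) (v : V) : H1 \subset H2 -> link H1 v \subset link H2 v.
Proof.
by move=> s; apply/subsetP => p; rewrite !inE => /andP[-> /(subsetP s)].
Qed.

Lemma delv_link_inj (H1 H2 : {set {set V}}) (v : V) :
  delv H1 v = delv H2 v -> link H1 v = link H2 v -> H1 = H2.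
Proof.
move=> /setP dE /setP lE; apply/setP => e.
have := dE e; have := lE (e :\ v); rewrite !inE eqxx /=.
case: (boolP (v \in e)) => ve; last by rewrite !andbT.
by rewrite setD1K.
Qed.

Lemma ctriples_sub U : ctriples U \subset triples U.
Proof. by apply/subsetP => e; rewrite inE => /andP[]. Qed.

Lemma delv_ctriples U v : delv (ctriples U) v = ctriples (U :\ v).
Proof.
apply/setP => e; rewrite !inE subsetD1.
by case: (e \subset U); case: (v \in e); rewrite ?andbF ?andbT.
Qed.

Lemma delv_triples U v : delv (triples U) v = triples (U :\ v).
Proof.
apply/setP => e; rewrite !inE subsetD1.
by case: (e \subset U); case: (v \in e); rewrite ?andbF ?andbT.
Qed.

Lemma delvS (H1 H2 : {set {set V}}) v : H1 \subset H2 -> delv H1 v \subset delv H2 v.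
Proof.
by move=> s; apply/subsetP => e; rewrite !inE => /andP[/(subsetP s)-> ->].
Qed.

Lemma delv_sub (H : {set {set V}}) v : delv H v \subset H.
Proof. by apply/subsetP => e; rewrite !inE => /andP[]. Qed.

Lemma card_ctriplesD1 U w :
  #|ctriples U| = #|ctriples (U :\ w)| + #|link (ctriples U) w|.
Proof. by rewrite (card_delv_link _ w) delv_ctriples. Qed.

Lemma in_link_triples U w p : w \in U ->
  (p \in link (triples U) w) = [&& w \notin p, p \subset U & #|p| == 2].
Proof.
move=> wU; rewrite !inE subUset sub1set wU /= cardsU1.
by case: (w \in p) => /=; rewrite ?eqSS.
Qed.

(* The number of vertices in [X] of the pairs forming a consistent triple with [w]. *)
Definition ctype (w : V) : nat := if w \in X then 1 else 2.

Lemma card_setU1I w p : w \notin p -> #|(w |: p) :&: X| = (w \in X) + #|p :&: X|.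
Proof.
move=> wp; rewrite setIUl; case: (boolP (w \in X)) => wX.
  have -> : [set w] :&: X = [set w] by apply/setIidPl; rewrite sub1set.
  by rewrite cardsU1 inE (negPf wp).
have -> : [set w] :&: X = set0; last by rewrite set0U.
by apply/setP => x; rewrite !inE; case: eqP => // ->; rewrite (negPf wX).
Qed.

Lemma in_link_ctriples U w p : w \in U ->
  (p \in link (ctriples U) w) =
    [&& w \notin p, p \subset U, #|p| == 2 & #|p :&: X| == ctype w].
Proof.
move=> wU; rewrite inE in_set; have := in_link_triples p wU.
rewrite inE; case: (boolP (w \in p)) => //= wp ->; rewrite card_setU1I // /ctype.
by rewrite -andbA; case: (w \in X).
Qed.

End Links.

(** * Deleting a vertex with an atypical link *)

(* The bound on [M] depends on [L], so for each [M] only the [L] with the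
   largest part outside [M] matters. *)
Lemma card_sparse_family (T : finType) (O : {set T}) (F : {set {set T}}) (g m r : nat) :
  #|O| <= m ->
  #|[set L : {set T} | (L \subset O) &&
      [exists M in F, 2 ^ (#|M| + g) * binsum m #|L :\: M| <= 2 ^ r]]| * 2 ^ g
    <= #|F| * 2 ^ r.
Proof.
move=> leOm; pose D (M : {set T}) := [set L : {set T} | (L \subset O) &&
  (2 ^ (#|M| + g) * binsum m #|L :\: M| <= 2 ^ r)].
apply: (@leq_trans (#|\bigcup_(M in F) D M| * 2 ^ g)).
  rewrite leq_mul2r; apply/orP; right; apply: subset_leq_card.
  apply/subsetP => L; rewrite inE => /andP[LO /exists_inP[M MF le]].
  by apply/bigcupP; exists M; rewrite ?inE ?LO.
apply: leq_trans (_ : (\sum_(M in F) #|D M|) * 2 ^ g <= _).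
  by rewrite leq_mul2r leq_card_bigcup orbT.
rewrite big_distrl -sum_nat_const; apply: leq_sum => M _ /=.
case: (set_0Vmem (D M)) => [->|[L0 L0D]]; first by rewrite cards0.
case: (arg_maxnP (fun L => #|L :\: M|) L0D) => L LD maxL.
have {LD} : L \in D M by []; rewrite inE => /andP[_ leL]; apply: leq_trans leL.
rewrite expnD mulnAC leq_mul2r; apply/orP; right.
apply: leq_trans (_ : _ <= #|[set L' : {set T} |
    (L' \subset O) && (#|L' :\: M| <= #|L :\: M|)]|) _.
  apply: subset_leq_card; apply/subsetP => L' L'D; move: (L'D); rewrite !inE.
  by case/andP=> -> _; apply: maxL.
apply: leq_trans (card_nearly_contained _ _ _) _.
rewrite leq_mul2l leq_binsum ?orbT //.
by apply: leq_trans leOm; rewrite subset_leq_card ?subsetDl.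
Qed.

Section Peeling.

Variables (V : finType) (X : {set V}) (g : nat).
Implicit Types (H : {set {set V}}) (U S p e : {set V}) (v w x y : V).

Local Notation n := #|V|.

(* Once [H], the hypergraph without [w], is known, there are only 2^O(n) sets
   [free_i]; the link of a bad vertex [w] lies almost entirely inside one of
   them that has far fewer pairs than there are consistent pairs at [w]. *)
Definition free1 U w S :=
  [set p in link (ctriples X U) w | ~~ (p \subset S)].
Definition free2 U w H v v' :=
  [set p in link (ctriples X U) w | ~~ ((v |: p \in H) && (v' |: p \in H))].
Definition free3 U w S :=
  [set p in link (ctriples X U) w | [disjoint p & S]].
Definition free4 U w S :=
  [set p in link (triples U) w |
     (#|p :&: X| == 1) && [disjoint p & S] || (p \subset S)].

Definition free U w H : {set {set {set V}}} :=
  [set free1 U w S | S : {set V}] :|: [set free2 U w H vv.1 vv.2 | vv : V * V] :|: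
  [set free3 U w S | S : {set V}] :|: [set free4 U w S | S : {set V}].

Definition bad_link U w H (L : {set {set V}}) : bool :=
  [exists M in free U w H,
     2 ^ (#|M| + g) * binsum (n ^ 2) #|L :\: M| <= 2 ^ #|link (ctriples X U) w|].

Definition bad U H w : bool := bad_link U w (delv H w) (link H w).

Lemma card_free U w H : #|free U w H| <= 3 * 2 ^ n + n ^ 2.
Proof.
have cP : #|{set V}| = 2 ^ n by have := card_powerset [set: V]; rewrite powersetT !cardsT.
have ci (f : {set V} -> {set {set V}}) : #|[set f S | S : {set V}]| <= 2 ^ n.
  by apply: leq_trans (leq_imset_card _ _) _; rewrite cP.
have c2 : #|[set free2 U w H vv.1 vv.2 | vv : V * V]| <= n ^ 2.
  by apply: leq_trans (leq_imset_card _ _) _; rewrite card_prod.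
apply: leq_trans (leq_card_setU _ _) _.
apply: leq_trans (leq_add (leq_card_setU _ _) (ci _)) _.
apply: leq_trans (leq_add (leq_add (leq_card_setU _ _) (ci _)) (leqnn _)) _.
apply: leq_trans (leq_add (leq_add (leq_add (ci _) c2) (leqnn _)) (leqnn _)) _.
lia.
Qed.

Lemma card_pairs U w : w \in U -> #|link (triples U) w| <= n ^ 2.
Proof.
move=> wU; apply: (@leq_trans #|[set [set uv.1; uv.2] | uv : V * V]|); last first.
  by apply: leq_trans (leq_imset_card _ _) _; rewrite card_prod.
apply: subset_leq_card; apply/subsetP => p; rewrite in_link_triples //.
by case/and3P=> _ _ /cards2P[u [v [_ ->]]]; apply/imsetP; exists (u, v).
Qed.

Lemma card_bad_links U w H : w \in U ->
  #|[set L : {set {set V}} | (L \subset link (triples U) w) && bad_link U w H L]|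
     * 2 ^ g <= (3 * 2 ^ n + n ^ 2) * 2 ^ #|link (ctriples X U) w|.
Proof.
move=> wU; apply: leq_trans (card_sparse_family _ _ _ (card_pairs wU)) _.
by rewrite leq_mul2r card_free orbT.
Qed.

Variable T : {set V} -> {set {set {set V}}}.
Hypothesis T_triples : forall U H, H \in T U -> H \subset triples U.
Hypothesis T_delv : forall U H w, H \in T U -> w \in U -> delv H w \in T (U :\ w).

(** Once [delv H w] is fixed, H is determined by the link of w, and [bad] constrains that link in
    terms of [delv H w] alone, so [card_bad_links] bounds each fibre. *)
Lemma card_bad_at U w : w \in U ->
  #|[set H in T U | bad U H w]| * 2 ^ g
    <= #|T (U :\ w)| * ((3 * 2 ^ n + n ^ 2) * 2 ^ #|link (ctriples X U) w|).
Proof.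
move=> wU; pose B (H : {set {set V}}) := [set L : {set {set V}} |
  (L \subset link (triples U) w) && bad_link U w H L].
apply: (@leq_trans ((\sum_(H in T (U :\ w)) #|B H|) * 2 ^ g)); last first.
  rewrite big_distrl -sum_nat_const; apply: leq_sum => H _ /=.
  exact: card_bad_links.
rewrite leq_mul2r; apply/orP; right; rewrite -sum1_card.
rewrite (partition_big (fun H => delv H w) (mem (T (U :\ w)))) /=; last first.
  by move=> H; rewrite inE => /andP[HT _]; exact: T_delv.
apply: leq_sum => H' _; rewrite sum1dep_card.
apply: (@leq_card_inj _ _ (fun H => link H w)).
  move=> H1 H2; rewrite !inE => /andP[_ /eqP e1] /andP[_ /eqP e2] el.
  by apply: (@delv_link_inj _ _ _ w); rewrite // e1 e2.
move=> H; rewrite !inE /= => /andP[/andP[/T_triples sH badH] /eqP <-].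
by rewrite -/(bad U H w) badH andbT linkS.
Qed.

Lemma card_some_bad U :
  #|[set H in T U | [exists w in U, bad U H w]]| * 2 ^ g
   <= \sum_(w in U) #|T (U :\ w)| * ((3 * 2 ^ n + n ^ 2) * 2 ^ #|link (ctriples X U) w|).
Proof.
apply: (@leq_trans ((\sum_(w in U) #|[set H in T U | bad U H w]|) * 2 ^ g)).
  rewrite leq_mul2r; apply/orP; right.
  apply: leq_trans (leq_card_bigcup _ _); apply: subset_leq_card.
  apply/subsetP => H; rewrite inE => /andP[HT /exists_inP[w wU bw]].
  by apply/bigcupP; exists w; rewrite // inE HT.
by rewrite big_distrl; apply: leq_sum => w wU; apply: card_bad_at.
Qed.

(** The consistent triples of U split into those avoiding w and those given by the pairs at w. Hence
    passing from U :\ w to U improves the ratio R / m by 2 ^ g, up to the number of choices of w and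
    of a free set. *)
Lemma card_some_bad_leq U R m :
  (forall w, w \in U -> #|T (U :\ w)| * m <= R * 2 ^ #|ctriples X (U :\ w)|) ->
  #|[set H in T U | [exists w in U, bad U H w]]| * 2 ^ g * m
   <= n * (3 * 2 ^ n + n ^ 2) * R * 2 ^ #|ctriples X U|.
Proof.
move=> leR; apply: leq_trans (leq_mul (card_some_bad U) (leqnn m)) _.
rewrite big_distrl /=.
apply: (@leq_trans (\sum_(w in U) (3 * 2 ^ n + n ^ 2) * R * 2 ^ #|ctriples X U|)).
  apply: leq_sum => w wU; rewrite (card_ctriplesD1 X U w) expnD [leqLHS]mulnAC.
  apply: leq_trans (leq_mul (leR w wU) (leqnn _)) _.
  by rewrite mulnACA (mulnC R).
by rewrite sum_nat_const -!mulnA leq_mul2r max_card orbT.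
Qed.

End Peeling.

(** * The structure left when no vertex is bad *)

Lemma leq_card_disjoint (T : finType) (A B C : {set T}) :
  A \subset C -> B \subset C -> [disjoint A & B] -> #|A| + #|B| <= #|C|.
Proof.
move=> sAC sBC; rewrite -setI_eq0 => /eqP dAB.
by rewrite -cardsUI dAB cards0 addn0 subset_leq_card // subUset sAC.
Qed.

Lemma card_pairs_through (V : finType) (F : {set {set V}}) (b : V) :
  (forall p, p \in F -> #|p| = 2) -> #|[set p in F | b \in p]| <= #|V|.
Proof.
move=> F2; apply: (@leq_trans #|[set [set b; u] | u : V]|); last first.
  exact: leq_imset_card.
apply: subset_leq_card; apply/subsetP => p; rewrite inE => /andP[/F2 p2 bp].
move: p2; rewrite (cardsD1 b) bp => -[/eqP/cards1P[u pE]].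
by apply/imsetP; exists u; rewrite // -pE setD1K.
Qed.

Lemma card_pairs_avoiding (V : finType) (F : {set {set V}}) (b : V) :
  (forall p, p \in F -> #|p| = 2) -> #|F| <= #|[set p in F | b \notin p]| + #|V|.
Proof.
move=> F2; apply: leq_trans (leq_add (leqnn _) (card_pairs_through b F2)).
apply: leq_trans (leq_card_setU _ _); apply: subset_leq_card; apply/subsetP => p.
by rewrite !inE => ->; case: (b \in p).
Qed.

Lemma card_pairs_meeting (V : finType) (F : {set {set V}}) (B : {set V}) (m : nat) :
  (forall p, p \in F -> #|p| = 2) ->
  (forall b, b \in B -> #|[set p in F | b \in p]| <= m) ->
  #|[set p in F | ~~ [disjoint p & B]]| <= #|B| * m.
Proof.
move=> F2 leFb; apply: leq_trans (_ : #|\bigcup_(b in B) [set p in F | b \in p]| <= _).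
  apply: subset_leq_card; apply/subsetP => p; rewrite inE => /andP[pF].
  by case/pred0Pn => b /andP[bp bB]; apply/bigcupP; exists b; rewrite ?inE ?pF.
by apply: leq_trans (leq_card_bigcup _ _) _; rewrite -sum_nat_const leq_sum.
Qed.

Section Structure.

Variables (V : finType) (X U : {set V}) (g : nat) (H : {set {set V}}).
Implicit Types (S p e : {set V}) (v w x y a b c : V).

Local Notation n := #|V|.
Local Notation N w := (link (ctriples X U) w).

Definition ltype (H' : {set {set V}}) (v : V) (j : nat) : {set {set V}} :=
  [set p in link H' v | #|p :&: X| == j].

Definition inconsistent : {set {set V}} := [set e in H | #|e :&: X| != 2].

(** This is the number of inconsistent triples through w (see [bdegE]), in the form that compares
    directly with the free sets. *)
Definition bdeg (w : V) : nat := #|link H w :\: N w|.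

Definition pdeg (a b : V) : nat := #|[set u in X | [set a; b; u] \in H]|.

Hypothesis HU : H \subset triples U.
Hypothesis T5H : ~~ has_copy T5 H.

Lemma H_3graph : is_3graph H.
Proof. by apply/forall_inP => e /(subsetP HU); rewrite inE => /andP[]. Qed.

Lemma H_card e : e \in H -> #|e| = 3.
Proof. by move/(subsetP HU); rewrite inE => /andP[_ /eqP]. Qed.

Lemma H_in e v : e \in H -> v \in e -> v \in U.
Proof. by move/(subsetP HU); rewrite inE => /andP[/subsetP + _]; apply. Qed.

Lemma link_pair v p : p \in link H v -> [/\ v \notin p, #|p| = 2, p \subset U & v \in U].
Proof.
rewrite inE => /andP[vp pH]; have vU := H_in pH (setU11 _ _).
have := subsetP HU _ pH; rewrite inE subUset cardsU1 vp eqSS => /andP[/andP[_ ->] /eqP->].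
by [].
Qed.

Lemma link_mem v p : #|p| = 2 -> v |: p \in H -> p \in link H v.
Proof. by move=> p2 pH; have := H_card pH; rewrite inE pH cardsU1 p2; case: (v \in p). Qed.

Lemma link_N w p : (p \in link H w :\: N w) = (p \in link H w) && (#|p :&: X| != ctype X w).
Proof.
rewrite inE andbC; case: (boolP (p \in link H w)) => //= /link_pair[wp p2 pU wU].
by rewrite in_link_ctriples // wp pU p2.
Qed.

Lemma net_gain_bad w (M : {set {set V}}) s r : M \in free X U w (delv H w) ->
  #|link H w :\: M| <= s -> #|M| + r <= #|N w| -> net_gain (n ^ 2) g s r -> bad X g U H w.
Proof.
move=> MF les leM gain; apply/exists_inP; exists M => //.
apply: leq_trans (_ : 2 ^ (#|M| + r) <= _); last by rewrite leq_exp2l.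
rewrite !expnD -mulnA leq_mul2l mulnC; apply/orP; right.
by apply: leq_trans gain; rewrite leq_mul2r leq_binsum ?orbT.
Qed.

(** A pair of the link outside M either has the wrong type or is a consistent pair that M leaves
    out. *)
Lemma bdeg_diff w (M : {set {set V}}) : M \subset N w ->
  #|link H w :\: M| <= bdeg w + #|link H w :&: (N w :\: M)|.
Proof.
move=> sM; apply: leq_trans (leq_card_setU _ _); apply: subset_leq_card.
by apply/subsetP => p; rewrite !in_setU !in_setD !in_setI !in_setD; do 3 case: (p \in _).
Qed.

(* With A the consistent pairs in the link of v, [T5]-freeness makes
   A, link b, link c have no common pair: either link b is small on the large
   set A, or link c misses the large set A :&: link b. *)
Lemma same_side_bad v b c z t1 t2 :
  [set v; b; c] \in H -> (b \in X) = (c \in X) -> bdeg b <= z -> bdeg c <= z ->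
  t1 + n <= #|ltype H v (ctype X b)| ->
  net_gain (n ^ 2) g (z + t2 + n) t1 -> net_gain (n ^ 2) g z t2 ->
  bad X g U H b || bad X g U H c.
Proof.
move=> vbcH bcX bz cz le1 gain1 gain2.
have [bU cU] : b \in U /\ c \in U.
  by split; apply: (H_in vbcH); rewrite !inE eqxx ?orbT.
have := H_card vbcH; rewrite -setUA cardsU1 cards2 !inE => vbc.
have [vb vc bc] : [/\ v != b, v != c & b != c].
  by move: vbc; case: (v == b); case: (v == c); case: (b == c).
have ctE : ctype X c = ctype X b by rewrite /ctype bcX.
pose A := [set p in N b | v |: p \in delv H b].
(* With both vertices equal to v, [free2] is [N b] minus the link of v in [delv H b], so its
   complement in [N b] is A. *)
have sA1 : free2 X U b (delv H b) v v \subset N b.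
  by apply/subsetP => p; rewrite inE => /andP[].
have A_E : N b :\: free2 X U b (delv H b) v v = A.
  apply/setP => p; rewrite in_setD /free2 [p \in A]inE [p \in [set _ in _ | _]]inE andbb.
  by case: (p \in N b); rewrite ?andbF //= andbT negbK.
have leA : t1 <= #|A|.
  (* Free sets at b may refer to [delv H b] only, so the pairs of the link of v through b are lost;
     there are at most n. *)
  rewrite -(leq_add2r n); apply: leq_trans le1 _.
  apply: leq_trans (@card_pairs_avoiding _ _ b _) _.
    by move=> p; rewrite inE => /andP[/link_pair[]].
  rewrite leq_add2r; apply: subset_leq_card; apply/subsetP => p; rewrite inE andbC => /andP[bp].
  rewrite inE => /andP[pl pt]; have [vp p2 pU _] := link_pair pl.
  rewrite inE in_link_ctriples // bp pU p2 pt inE; move: pl; rewrite inE vp /= => ->.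
  by rewrite in_setU1 negb_or eq_sym vb.
case: (leqP #|link H b :&: A| (t2 + n)) => le2.
  apply/orP; left; apply: (@net_gain_bad b (free2 X U b (delv H b) v v)) gain1.
  - by rewrite !in_setU (_ : _ \in [set free2 _ _ _ _ _ _ | _ : _]) ?orbT //;
      apply/imsetP; exists (v, v).
  - by apply: leq_trans (bdeg_diff sA1) _; rewrite A_E -addnA leq_add.
  by rewrite -[leqRHS](cardsID (free2 X U b (delv H b) v v)) (setIidPr sA1) A_E leq_add2l.
apply/orP; right; pose A' := [set p in link H b :&: A | c \notin p].
have leA' : t2 <= #|A'|.
  rewrite -(leq_add2r n); apply: leq_trans (ltnW le2) _.
  by apply: card_pairs_avoiding => p; rewrite inE => /andP[/link_pair[]].
pose M := free2 X U c (delv H c) v b.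
have sM : M \subset N c by apply/subsetP => p; rewrite inE => /andP[].
have A'P p : p \in A' -> [/\ p \in N c, v |: p \in delv H c & b |: p \in delv H c].
  rewrite [_ \in A']inE in_setI => /andP[/andP[pb]]; rewrite [_ \in A]inE.
  rewrite (in_link_ctriples X p bU) => /andP[/and4P[bp pU p2 pt] vpH] cp.
  move: pb vpH; rewrite (in_link_ctriples X p cU) !inE ctE pt p2 pU cp /=.
  by rewrite bp /= ![c == _]eq_sym (negPf vc) (negPf bc) /= => -> /andP[->].
apply: (@net_gain_bad c M z t2) => //.
- by rewrite !in_setU (_ : M \in [set free2 _ _ _ _ _ _ | _ : _]) ?orbT //;
      apply/imsetP; exists (v, b).
- apply: leq_trans cz; apply: subset_leq_card; apply/subsetP => p.
  rewrite !in_setD => /andP[pM pc]; rewrite pc andbT; apply: contra pM => pN.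
  rewrite inE pN /=; apply/negP => /andP[]; rewrite !inE => /andP[vpH _] /andP[bpH _].
  have [cp p2 _ _] := link_pair pc; have cpH : c |: p \in H by move: pc; rewrite inE => /andP[].
  have := link_mem p2 vpH; have := link_mem p2 bpH; rewrite !inE.
  move=> /andP[bp _] /andP[vp _].
  exact: (T5_freeF H_3graph T5H vp bp cp vpH bpH cpH vbcH).
rewrite (leq_trans (_ : _ <= #|M| + #|A'|)) ?leq_add2l //.
apply: leq_card_disjoint => //; first by apply/subsetP => p /A'P[].
rewrite -setI_eq0; apply/eqP/setP => p; rewrite in_setI in_set0.
by apply/negP => /andP[]; rewrite inE => /andP[_ /negP h] /A'P[_ h1 h2]; apply: h; rewrite h1.
Qed.

End Structure.

(* The intended orders of magnitude are
   z << t2 << t1 << mu^2 << n * mu << n * ka << t2' << t1' << n^2, with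
   [th_h] bounding the number of vertices in more than z inconsistent triples;
   [x0] bounds the size of [X] from below, [y0] and [y1] that of its complement. *)
Record thresholds (n g I en x0 y0 y1 mu ka : nat) : Type := Thresholds {
  th_z : nat; th_t1 : nat; th_t2 : nat; th_z' : nat; th_t1' : nat; th_t2' : nat;
  th_h : nat; th_g3 : nat; th_g4 : nat; th_g6 : nat; th_g7 : nat;
  th_z_gt0 : 0 < th_z;
  th_high : 3 * I <= th_h * th_z;
  th_small : th_h * n + en < th_t1 + n;
  th_z'Y : 2 * (th_t1 + n) <= th_z';
  th_z'X : th_t1 + n + en + ka ^ 2 <= th_z';
  th_xy3 : 'C(y1, 2) + th_g3 <= 'C(x0, 2);
  th_xy4 : 2 * th_g4 <= ka * x0.-1;
  th_xy6 : 2 * th_g6 + ka * y1 <= 2 * (ka * x0.-1);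
  th_y1 : y1 <= 2 * x0.-1;
  th_x7 : th_g7 <= 'C(x0, 2);
  th_xy7 : th_g7 <= x0.-1 * y0;
  th_ok1 : net_gain (n ^ 2) g (th_z + th_t2 + n) th_t1;
  th_ok2 : net_gain (n ^ 2) g th_z th_t2;
  th_ok3 : net_gain (n ^ 2) g (2 * (th_t1 + n)) th_g3;
  th_ok4 : net_gain (n ^ 2) g (2 * (th_t1 + n) + n * mu) th_g4;
  th_ok5 : net_gain (n ^ 2) g (2 * (th_t1 + n)) 'C(mu, 2);
  th_ok6 : net_gain (n ^ 2) g (th_t1 + n + en + n * mu) th_g6;
  th_ok7 : net_gain (n ^ 2) g (th_t1' + n + th_z') th_g7;
  th_ok8 : net_gain (n ^ 2) g (th_z' + th_t2' + n) th_t1';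
  th_ok9 : net_gain (n ^ 2) g th_z' th_t2'
}.

Lemma sum_card_incidence (V : finType) (F : {set {set V}}) (k : nat) :
  (forall e, e \in F -> #|e| = k) -> \sum_v #|[set e in F | v \in e]| = #|F| * k.
Proof.
move=> Fk; under eq_bigr do rewrite -sum1dep_card big_mkcondr.
rewrite exchange_big /= -sum_nat_const; apply: eq_bigr => e /Fk <-.
by rewrite -big_mkcond sum1_card.
Qed.

Lemma bin2_double (m : nat) : 2 * 'C(m, 2) = m * m.-1.
Proof. by rewrite mul2n bin2 -[RHS]odd_double_half oddM; case: m => //= m; rewrite andNb. Qed.

(** The difference of the binomials is a (2x - a - 1) / 2, which is at least a (x - 1) / 2 because a
    <= x. *)
Lemma bin2_sub_leq (x a r ka x0 : nat) : ka <= a -> a <= x -> x0 <= x ->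
  2 * r <= ka * x0.-1 -> 'C(x - a, 2) + r <= 'C(x, 2).
Proof.
move=> leka lea lex ler; rewrite -(leq_pmul2l (ltn0Sn 1)) mulnDr !bin2_double.
case: x lea lex => [|x] lea lex; first by nia.
have : ka * x0.-1 <= a * x by apply: leq_mul => //; lia.
move=> le1; have -> : (x.+1 - a).-1 = x - a by lia.
case: a lea leka le1 => [|a] lea leka le1; first by nia.
rewrite /= subSS; have [b xE] : exists b, x = a + b by exists (x - a); lia.
subst x; rewrite addKn; have -> : a + b - a.+1 = b.-1 by lia.
by case: b le1 lea lex => [|b] *; nia.
Qed.

(** * Two rounds of bounds for a nearly optimal partition without bad vertices *)

Section NoBadVertex.

Variables (V : finType) (X U : {set V}) (g : nat) (H : {set {set V}}).
Implicit Types (S p e : {set V}) (v w x y a b c : V).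

Local Notation n := #|V|.
Local Notation N w := (link (ctriples X U) w).
Local Notation L j v := (ltype X H v j).
Local Notation bdeg := (bdeg X U H).
Local Notation pdeg := (pdeg X H).
Local Notation XU := (U :&: X).
Local Notation YU := (U :\: X).

Variables (I en x0 y0 y1 mu ka : nat).
Variable th : thresholds n g I en x0 y0 y1 mu ka.

Hypothesis HU : H \subset triples U.
Hypothesis T5H : ~~ has_copy T5 H.
Hypothesis HI : #|inconsistent X H| <= I.
Hypothesis optX : forall x, x \in X -> #|L 2 x| <= #|L 1 x| + en.
Hypothesis optY : forall y, y \notin X -> #|L 1 y| <= #|L 2 y| + en.
Hypothesis lex0 : x0 <= #|XU|.
Hypothesis ley0 : y0 <= #|YU|.
Hypothesis ley1 : #|YU| <= y1.
Hypothesis nobad : forall w, w \in U -> ~~ bad X g U H w.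

Local Notation t := (th_t1 th + n).

Lemma ltype_link v j p : p \in L j v ->
  [/\ v \notin p, #|p| = 2, p \subset U, v \in U & v |: p \in H].
Proof.
rewrite inE => /andP[pl _]; have [vp p2 pU vU] := link_pair HU pl.
by move: pl; rewrite inE vp.
Qed.

Lemma bdegE w : bdeg w = #|[set e in inconsistent X H | w \in e]|.
Proof.
rewrite -card_link; apply: eq_card => p; rewrite (link_N X HU) [RHS]inE !in_set.
by case: (boolP (w \in p)) => //= wp; rewrite card_setU1I // /ctype; case: (w \in X).
Qed.

Definition high : {set V} := [set w in U | th_z th < bdeg w].

(** Markov's inequality: the sum of [bdeg] counts every inconsistent triple three times. *)
Lemma card_high : #|high| <= th_h th.
Proof.
rewrite -(leq_pmul2r (th_z_gt0 th)); apply: leq_trans (th_high th).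
apply: leq_trans (_ : 3 * #|inconsistent X H| <= _); last by rewrite leq_mul2l HI.
rewrite mulnC [leqRHS]mulnC -sum_card_incidence; last first.
  by move=> e; rewrite inE => /andP[/(H_card HU)].
rewrite mulnC -sum_nat_const.
apply: leq_trans (_ : \sum_(w in high) bdeg w <= _).
  by apply: leq_sum => w; rewrite inE => /andP[_ /ltnW].
rewrite big_mkcond; apply: leq_sum => w _; case: ifP => // _.
by rewrite bdegE.
Qed.

Lemma pairs_in_high (F : {set {set V}}) :
  (forall p, p \in F -> #|p| = 2 /\ exists2 w, w \in p & w \in high) ->
  #|F| <= th_h th * n.
Proof.
move=> FP; rewrite (_ : F = [set p in F | ~~ [disjoint p & high]]); last first.
  apply/setP => p; rewrite inE; case: (boolP (p \in F)) => //= /FP[_ [w wp wh]].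
  by symmetry; apply/pred0Pn; exists w; apply/andP.
apply: leq_trans (_ : #|high| * n <= _); last by rewrite leq_mul2r card_high orbT.
apply: card_pairs_meeting => [p /FP[]//|b _].
by apply: card_pairs_through => p /FP[].
Qed.

(** First round of [same_side_bad]: if b and c were both outside [high], one of them would be bad.
    With [pairs_in_high], this bounds the pairs inside one part in a rich link. *)
Lemma same_side_not_high v b c : v \in U -> [set v; b; c] \in H ->
  (b \in X) = (c \in X) -> t <= #|L (ctype X b) v| -> (b \in high) || (c \in high).
Proof.
move=> vU vbcH bc le1; apply: contraT; rewrite negb_or.
have [bU cU] : b \in U /\ c \in U.
  by split; apply: (H_in HU vbcH); rewrite !inE eqxx ?orbT.
rewrite !inE bU cU -!leqNgt /= => /andP[lb lc].
have := same_side_bad HU T5H vbcH bc lb lc le1 (th_ok1 th) (th_ok2 th).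
by rewrite !(negPf (nobad _)).
Qed.

Lemma pair_cases p : #|p| = 2 ->
  [\/ #|p :&: X| = 0 /\ forall b, b \in p -> b \notin X,
      #|p :&: X| = 1 /\ exists u b, [/\ u \in X, b \notin X & p = [set u; b]] |
      #|p :&: X| = 2 /\ forall b, b \in p -> b \in X].
Proof.
move=> p2; have := cardsID X p; rewrite p2.
case E : #|p :&: X| => [|[|[|k]]] // eq1.
- constructor 1; split => // b bp; apply/negP => bX.
  by move/eqP: E; rewrite cards_eq0 => /eqP/setP/(_ b); rewrite !inE bp bX.
- constructor 2; split => //; move: eq1 => [/eqP/cards1P[b bE]].
  move/eqP: E => /cards1P[u uE]; exists u, b; rewrite -(setID p X) uE bE; split=> //.
    by have := set11 u; rewrite -uE inE => /andP[].
  by have := set11 b; rewrite -bE inE => /andP[].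
constructor 3; split => // b bp; move: eq1 => /eqP.
rewrite -[X in _ == X]addn0 eqn_add2l cards_eq0 => /eqP/setP/(_ b).
by rewrite !inE bp andbT => /negbFE.
Qed.

Lemma L2_mem v p b : p \in L 2 v -> b \in p -> b \in X.
Proof.
move=> pl; have [_ p2 _ _ _] := ltype_link pl; move: pl; rewrite inE => /andP[_ /eqP E].
by case: (pair_cases p2) => -[]; rewrite E // => _; apply.
Qed.

Lemma L0_mem v p b : p \in L 0 v -> b \in p -> b \notin X.
Proof.
move=> pl; have [_ p2 _ _ _] := ltype_link pl; move: pl; rewrite inE => /andP[_ /eqP E].
by case: (pair_cases p2) => -[]; rewrite E // => _; apply.
Qed.

Lemma edge_of_link v b c : v |: [set b; c] = [set v; b; c].
Proof. by rewrite setUA. Qed.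

Lemma card_L2 v : v \in U -> t <= #|L 1 v| -> #|L 2 v| <= th_h th * n.
Proof.
move=> vU le1; apply: pairs_in_high => p pl; have [_ p2 _ _ pH] := ltype_link pl.
split=> //; move: (p2) => /eqP/cards2P[b [c [_ pE]]].
have bX : b \in X by apply: (L2_mem pl); rewrite pE !inE eqxx.
have cX : c \in X by apply: (L2_mem pl); rewrite pE !inE eqxx orbT.
move: pH; rewrite pE edge_of_link => vbcH.
have := same_side_not_high vU vbcH; rewrite bX cX /ctype bX => /(_ erefl le1).
by case/orP=> h; [exists b | exists c]; rewrite // !inE eqxx ?orbT.
Qed.

Lemma card_L0 v : v \in U -> t <= #|L 2 v| -> #|L 0 v| <= th_h th * n.
Proof.
move=> vU le1; apply: pairs_in_high => p pl; have [_ p2 _ _ pH] := ltype_link pl.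
split=> //; move: (p2) => /eqP/cards2P[b [c [_ pE]]].
have bX : b \notin X by apply: (L0_mem pl); rewrite pE !inE eqxx.
have cX : c \notin X by apply: (L0_mem pl); rewrite pE !inE eqxx orbT.
move: pH; rewrite pE edge_of_link => vbcH.
have := same_side_not_high vU vbcH; rewrite (negPf bX) (negPf cX) /ctype (negPf bX).
move=> /(_ erefl le1).
by case/orP=> h; [exists b | exists c]; rewrite // !inE eqxx ?orbT.
Qed.

(** If few pairs at x have type 1, optimality limits those of type 2; otherwise [card_L2] does. *)
Lemma card_L2_X x : x \in U -> x \in X -> #|L 2 x| <= t + en.
Proof.
move=> xU xX; case: (leqP t #|L 1 x|) => [/(card_L2 xU) le|lt]; last first.
  by apply: leq_trans (optX xX) _; rewrite leq_add2r ltnW.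
by apply: leq_trans le _; have := th_small th; lia.
Qed.

(** Many pairs of type 1 would leave few of type 2 by [card_L2]; optimality would then leave few of
    type 1, contradicting [th_small]. *)
Lemma card_L1_Y y : y \in U -> y \notin X -> #|L 1 y| < t.
Proof.
move=> yU yX; rewrite ltnNge; apply/negP => le; have := card_L2 yU le.
by have := optY yX; have := th_small th; lia.
Qed.

Lemma link_cases v p : p \in link H v -> [|| p \in L 0 v, p \in L 1 v | p \in L 2 v].
Proof.
move=> pl; have [_ p2 _ _] := link_pair HU pl; rewrite !inE in pl *.
by rewrite pl /=; case: (pair_cases p2) => -[-> _].
Qed.

Lemma T5F p a b c : #|p| = 2 -> a |: p \in H -> b |: p \in H -> c |: p \in H ->
  [set a; b; c] \in H -> False.
Proof.
move=> p2 aH bH cH; apply: (T5_freeF (H_3graph HU) T5H (p := p)) => //.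
- by have := link_mem HU p2 aH; rewrite inE => /andP[].
- by have := link_mem HU p2 bH; rewrite inE => /andP[].
by have := link_mem HU p2 cH; rewrite inE => /andP[].
Qed.

Lemma in_free1 w S : free1 X U w S \in free X U w (delv H w).
Proof. by rewrite !in_setU imset_f. Qed.

Lemma in_free3 w S : free3 X U w S \in free X U w (delv H w).
Proof. by rewrite !in_setU (imset_f (free3 X U w)) ?orbT. Qed.

Lemma in_free4 w S : free4 X U w S \in free X U w (delv H w).
Proof. by rewrite !in_setU (imset_f (free4 X U w)) ?orbT. Qed.

Lemma card_N_Y y : y \in U -> y \notin X -> #|N y| = 'C(#|XU|, 2).
Proof.
move=> yU yX; rewrite -cards_draws; apply: eq_card => p.
rewrite in_link_ctriples // inE /ctype (negPf yX) subsetI.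
apply/and4P/andP => [[yp pU p2 pt]|[/andP[pU pX] p2]].
  rewrite pU p2; split=> //=.
  by apply/setIidPl/eqP; rewrite eqEcard subsetIl (eqP p2) (eqP pt).
split=> //; last by rewrite (setIidPl pX).
by apply: contra yX => /(subsetP pX).
Qed.

(* Otherwise the link of y is essentially a graph on the smaller side Y. *)
Lemma L2_Y_large y : y \in U -> y \notin X -> t <= #|L 2 y|.
Proof.
move=> yU yX; rewrite leqNgt; apply: (contraNN _ (nobad yU)) => lt2.
(* A pair with one vertex in X meets ~: X, so for this S only the pairs inside the part Y remain in
   [free4]. *)
apply: (net_gain_bad (in_free4 y (~: X)) _ _ (th_ok3 th)).
  apply: (@leq_trans (#|L 1 y| + #|L 2 y|)); last first.
    by have := card_L1_Y yU yX; lia.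
  apply: leq_trans (leq_card_setU _ _); apply: subset_leq_card.
  apply/subsetP => p; rewrite in_setD in_setU => /andP[pM pl].
  case/orP: (link_cases pl) => // p0; case/negP: pM.
  rewrite inE in_link_triples //; have [yp p2 pU _] := link_pair HU pl.
  rewrite yp pU p2 /=; apply/orP; right; apply/subsetP => b bp.
  by rewrite inE (L0_mem p0 bp).
rewrite card_N_Y //; apply: leq_trans (leq_trans (th_xy3 th) (leq_bin2l _ lex0)).
rewrite leq_add2r; apply: leq_trans (leq_bin2l 2 ley1).
rewrite -cards_draws; apply: subset_leq_card; apply/subsetP => p.
rewrite inE in_link_triples // inE => /andP[/and3P[_ pU p2]].
have sub : p \subset ~: X -> (p \subset YU) && (#|p| == 2).
  by rewrite p2 andbT setDE subsetI pU.
case/orP=> // /andP[]; rewrite disjoint_sym disjoints_subset => p1 /subsetP s.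
have : p \subset X by apply/subsetP => b bp; apply: contraT => bX;
  have := s b; rewrite !inE bX bp => /(_ isT).
by move=> /setIidPl pX; rewrite pX (eqP p2) in p1.
Qed.

Lemma bdeg_Y y : y \in U -> y \notin X -> bdeg y <= 2 * t.
Proof.
move=> yU yX; apply: (@leq_trans (#|L 1 y| + #|L 0 y|)); last first.
  have := card_L1_Y yU yX; have := card_L0 yU (L2_Y_large yU yX).
  have := th_small th; lia.
apply: leq_trans (leq_card_setU _ _); apply: subset_leq_card.
apply/subsetP => p; rewrite link_N // /ctype (negPf yX) in_setU => /andP[pl pt].
case/or3P: (link_cases pl) => [->|->|]; rewrite ?orbT //.
by rewrite inE (negPf pt) andbF.
Qed.

Lemma pdegC a b : pdeg a b = pdeg b a.
Proof. by apply: eq_card => u; rewrite !inE (setUC [set a]). Qed.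

Lemma pairs_through_pdeg (F : {set {set V}}) v a :
  (forall p, p \in F -> #|p| = 2 /\ v |: p \in H) ->
  (forall p u, p \in F -> u \in p -> u != a -> u \in X) ->
  #|[set p in F | a \in p]| <= pdeg v a.
Proof.
move=> F2 FX; apply: leq_trans (leq_imset_card (fun u => [set a; u]) _).
apply: subset_leq_card; apply/subsetP => p; rewrite inE => /andP[pF ap].
have [p2 vpH] := F2 p pF; move: p2; rewrite (cardsD1 a) ap => -[/eqP/cards1P[u pE]].
have := set11 u; rewrite -pE !inE => /andP[ua up].
apply/imsetP; exists u; last by rewrite -pE setD1K.
by rewrite inE (FX p) //= -edge_of_link -pE setD1K.
Qed.

Definition sparseX y : {set V} := [set a in XU | pdeg a y < mu].
Definition sparseY x : {set V} := [set b in YU | pdeg x b < mu].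

(** Each vertex of [sparseX y] lies in fewer than mu pairs of [L 2 y], so all but n * mu of these
    pairs avoid [sparseX y]. If that set had ka elements, this confinement would make y bad. *)
Lemma card_sparseX y : y \in U -> y \notin X -> #|sparseX y| < ka.
Proof.
move=> yU yX; rewrite ltnNge; apply: (contraNN _ (nobad yU)) => leka.
apply: (net_gain_bad (in_free3 y (sparseX y)) _ _ (th_ok4 th)).
  have le1 := card_L1_Y yU yX; have le0 := card_L0 yU (L2_Y_large yU yX).
  have small := th_small th.
  apply: (@leq_trans (#|L 0 y| + #|L 1 y| +
    #|[set p in L 2 y | ~~ [disjoint p & sparseX y]]|)).
    apply: leq_trans (leq_add (leq_card_setU _ _) (leqnn _)).
    apply: leq_trans (leq_card_setU _ _).
    apply: subset_leq_card; apply/subsetP => p; rewrite in_setD !in_setU => /andP[pM pl].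
    case/or3P: (link_cases pl) => [->|->|p3]; rewrite ?orbT //; apply/orP; right.
    rewrite inE p3 /=; apply: contra pM => dis; rewrite inE dis andbT in_link_ctriples //.
    have [yp p2 pU _] := link_pair HU pl; rewrite yp pU p2 /ctype (negPf yX) /=.
    by move: p3; rewrite inE => /andP[].
  suff : #|[set p in L 2 y | ~~ [disjoint p & sparseX y]]| <= n * mu by lia.
  apply: leq_trans (@card_pairs_meeting _ _ _ mu _ _) _.
  - by move=> p /ltype_link[].
  - move=> a; rewrite inE pdegC => /andP[_ /ltnW]; apply: leq_trans.
    apply: pairs_through_pdeg => [p /ltype_link[]//|p u pF up _].
    exact: (L2_mem pF).
  by rewrite leq_mul2r max_card orbT.
rewrite card_N_Y //.
have le1 : #|free3 X U y (sparseX y)| <= 'C(#|XU| - #|sparseX y|, 2).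
  have sub : sparseX y \subset XU by apply/subsetP => a; rewrite inE => /andP[].
  rewrite -cardsDS // -cards_draws; apply: subset_leq_card; apply/subsetP => p.
  rewrite inE in_link_ctriples // /ctype (negPf yX) inE => /andP[/and4P[yp pU p2 pt] dis].
  rewrite p2 andbT subsetD dis andbT subsetI pU /=.
  apply/setIidPl/eqP; rewrite eqEcard subsetIl (eqP p2) (eqP pt); done.
have lea : #|sparseX y| <= #|XU|.
  by apply: subset_leq_card; apply/subsetP => a; rewrite inE => /andP[].
apply: leq_trans (leq_add le1 (leqnn _)) _.
by apply: bin2_sub_leq (th_xy4 th); rewrite // leq_add2r.
Qed.

(* The common neighbours S of x and b in X form a set without pairs in the
   link of c, so S is small unless c is bad. *)
Lemma sparse_pair x b c : x \in X -> b \notin X -> c \notin X ->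
  [set x; b; c] \in H -> pdeg x b < mu.
Proof.
move=> xX bX cX xbcH; rewrite ltnNge; apply/negP => lemu.
have xb : x != b by apply: contraNneq bX => <-.
have xb2 : #|[set x; b]| = 2 by rewrite cards2 xb.
have xbc : c |: [set x; b] \in H by rewrite setUC.
have cU : c \in U by apply: (H_in HU xbcH); rewrite !inE eqxx orbT.
have /negP[] := nobad cU.
pose S := [set u in X | [set x; b; u] \in H].
have SP u : u \in S -> u \in X /\ u |: [set x; b] \in H.
  by rewrite inE => /andP[-> uH]; rewrite setUC.
apply: (net_gain_bad (in_free1 c S) _ _ (th_ok5 th)).
  apply: leq_trans (bdeg_Y cU cX).
  have sub : free1 X U c S \subset N c by apply/subsetP => p; rewrite inE => /andP[].
  apply: leq_trans (bdeg_diff H sub) _; rewrite -[leqRHS]addn0 leq_add2l leqn0 cards_eq0.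
  apply/eqP/setP => p; rewrite in_set0; apply/negP; rewrite in_setI in_setD.
  case/and3P => pc pM pN; move: pM; rewrite inE pN negbK /= => pS.
  have [cp p2 _ _] := link_pair HU pc; move/eqP/cards2P: (p2) => [u [u' [_ pE]]].
  have [uX uH] : u \in X /\ u |: [set x; b] \in H.
    by apply/SP/(subsetP pS); rewrite pE !inE eqxx.
  have [u'X u'H] : u' \in X /\ u' |: [set x; b] \in H.
    by apply/SP/(subsetP pS); rewrite pE !inE eqxx orbT.
  apply: (T5F xb2 xbc uH u'H); rewrite -edge_of_link -pE.
  by move: pc; rewrite inE => /andP[].
apply: leq_trans (_ : #|free1 X U c S| + 'C(#|S|, 2) <= _).
  by rewrite leq_add2l leq_bin2l.
rewrite -cards_draws; apply: leq_card_disjoint.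
- by apply/subsetP => p; rewrite inE => /andP[].
- apply/subsetP => p; rewrite inE => /andP[pS p2].
  have pX : p \subset X by apply/subsetP => u /(subsetP pS)/SP[].
  rewrite in_link_ctriples // p2 /ctype (negPf cX) (setIidPl pX) p2 !andbT /=.
  rewrite (contra (subsetP pX c)) //=; apply/subsetP => u /(subsetP pS)/SP[_ uH].
  by apply: (H_in HU uH); rewrite !inE eqxx.
rewrite -setI_eq0; apply/eqP/setP => p; rewrite !inE.
by case: (p \subset S); rewrite ?andbF.
Qed.

Lemma L0_sparseY x p : x \in X -> p \in L 0 x -> p \subset sparseY x.
Proof.
move=> xX pl; have [xp p2 pU _ pH] := ltype_link pl.
move/eqP/cards2P: (p2) => [b [c [_ pE]]].
have bX : b \notin X by apply: (L0_mem pl); rewrite pE !inE eqxx.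
have cX : c \notin X by apply: (L0_mem pl); rewrite pE !inE eqxx orbT.
have xbcH : [set x; b; c] \in H by rewrite -edge_of_link -pE.
have xcbH : [set x; c; b] \in H by rewrite setUAC.
move: pU; rewrite pE !subUset !sub1set !inE bX cX => /andP[-> ->] /=.
by rewrite (sparse_pair xX bX cX xbcH) (sparse_pair xX cX bX xcbH).
Qed.

Lemma card_mixed_pairs x (D : {set V}) : x \in X -> D \subset YU ->
  #|[set [set ub.1; ub.2] | ub in setX (XU :\ x) D]| = #|XU :\ x| * #|D|.
Proof.
move=> xX /subsetP sD; rewrite card_in_imset ?cardsX // => -[u b] [u' b'].
rewrite !in_setX /= => /andP[/setD1P[_ /setIP[_ uX]] /sD/setDP[_ bX]].
move=> /andP[/setD1P[_ /setIP[_ u'X]] /sD/setDP[_ b'X]] /setP E.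
have : u \in [set u'; b'] by rewrite -E !inE eqxx.
have : b \in [set u'; b'] by rewrite -E !inE eqxx orbT.
rewrite !inE => /orP[/eqP bE|/eqP->]; first by rewrite bE u'X in bX.
by move=> /orP[/eqP->//|/eqP uE]; rewrite -uE uX in b'X.
Qed.

Lemma mixed_pairs_N x (D : {set V}) : x \in U -> x \in X -> D \subset YU ->
  [set [set ub.1; ub.2] | ub in setX (XU :\ x) D] \subset N x.
Proof.
move=> xU xX /subsetP sD; apply/subsetP => p /imsetP[[u b] + ->].
rewrite in_setX /= => /andP[/setD1P[ux /setIP[uU uX]] /sD/setDP[bU bX]].
have xb : x != b by apply: contraNneq bX => <-.
have ub : u != b by apply: contraNneq bX => <-.
rewrite in_link_ctriples // !inE negb_or eq_sym ux xb subUset !sub1set uU bU cards2 ub.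
rewrite /ctype xX setIUl (setIidPl _) ?sub1set //= (_ : _ :&: X = set0) ?setU0 ?cards1 //.
by apply/setP => c; rewrite !inE; case: eqP => // ->; rewrite (negPf bX).
Qed.

Lemma card_XUD1 x : x \in U -> x \in X -> #|XU :\ x| = #|XU|.-1.
Proof. by move=> xU xX; rewrite [in RHS](cardsD1 x) inE xU xX. Qed.

(* If D = sparseY x is large, the link of x lies essentially in
   (X * (Y :\: D)) together with the pairs inside D, and |D| |X| > |D|^2 / 2. *)
Lemma card_sparseY x : x \in U -> x \in X -> #|sparseY x| < ka.
Proof.
move=> xU xX; rewrite ltnNge; apply: (contraNN _ (nobad xU)) => leka.
have subD : sparseY x \subset YU by apply/subsetP => b; rewrite inE => /andP[].
apply: (net_gain_bad (in_free4 x (sparseY x)) _ _ (th_ok6 th)).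
  apply: (@leq_trans (#|L 2 x| + #|[set p in L 1 x | ~~ [disjoint p & sparseY x]]|)).
    apply: leq_trans (leq_card_setU _ _); apply: subset_leq_card.
    apply/subsetP => p; rewrite in_setD in_setU => /andP[pM pl].
    have [xp p2 pU _] := link_pair HU pl; move: pM.
    rewrite [X in ~~ X -> _]inE in_link_triples // xp pU p2 negb_or /=.
    case/or3P: (link_cases pl) => [/(L0_sparseY xX)->|pl1|->//]; first by rewrite andbF.
    case/andP=> + _; have := pl1; rewrite inE => /andP[_ ->] /= dis.
    by apply/orP; right; rewrite inE pl1.
  apply: leq_add; first exact: card_L2_X.
  apply: leq_trans (@card_pairs_meeting _ _ _ mu _ _) _.
  - by move=> p /ltype_link[].
  - move=> b; rewrite inE => /andP[/setDP[_ bX] /ltnW]; apply: leq_trans.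
    apply: leq_trans (_ : _ <= #|[set p in [set p in L 1 x | b \in p] | b \in p]|) _.
      by apply: subset_leq_card; apply/subsetP => p; rewrite !inE => /andP[-> ->].
    apply: pairs_through_pdeg => [p|p u]; rewrite inE => /andP[pl bp].
      by have [] := ltype_link pl.
    move=> up ub; have [_ p2 _ _ _] := ltype_link pl; move: pl; rewrite inE => /andP[_ /eqP p1].
    case: (pair_cases p2) => -[]; rewrite p1 // => _ [u0 [b0 [u0X b0X pE]]].
    move: up ub bp; rewrite pE !inE => /orP[/eqP->//|/eqP->] bb /orP[/eqP bu|/eqP bE].
      by rewrite bu u0X in bX.
    by rewrite bE eqxx in bb.
  by rewrite leq_mul2r max_card orbT.
set M := free4 _ _ _ _.
pose M1 := [set p in N x | [disjoint p & sparseY x]].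
pose M2 := [set [set ub.1; ub.2] | ub in setX (XU :\ x) (sparseY x)].
have leM : #|M| <= #|M1| + 'C(#|sparseY x|, 2).
  rewrite -cards_draws; apply: leq_trans (leq_card_setU _ _).
  apply: subset_leq_card; apply/subsetP => p.
  rewrite inE in_link_triples // in_setU.
  case/andP=> /and3P[xp pU p2] /orP[/andP[pt dis]|pD]; apply/orP; [left|right].
    by rewrite inE in_link_ctriples // /ctype xX xp pU p2 pt.
  by rewrite inE pD.
have leN : #|M1| + #|M2| <= #|N x|.
  apply: leq_card_disjoint; first by apply/subsetP => p; rewrite inE => /andP[].
    exact: mixed_pairs_N.
  rewrite -setI_eq0; apply/eqP/setP => p; rewrite in_setI in_set0.
  apply/negP => /andP[]; rewrite inE => /andP[_ dis] /imsetP[[u b]].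
  rewrite in_setX /= => /andP[_ bD] pE.
  have bp : b \in p by rewrite pE !inE eqxx orbT.
  by move/pred0P: dis => /(_ b) /=; rewrite bp bD.
rewrite card_mixed_pairs // card_XUD1 // in leN.
apply: leq_trans leN; apply: leq_trans (leq_add leM (leqnn _)) _.
rewrite -addnA leq_add2l.
have := th_xy6 th; have := th_y1 th; have := leq_trans (subset_leq_card subD) ley1.
have := bin2_double #|sparseY x|; move: leka lex0.
move: #|sparseY x| #|XU| => d xu lekd lexu eqd ledy ley le6.
(* Twice the saving is 2d (xu - 1) - d (d - 1). As d <= y1, it is at least d (2 (x0 - 1) - y1),
   which is smallest at d = ka. *)
have kd : (ka * (2 * x0.-1 - y1) <= d * (2 * x0.-1 - y1))%N by rewrite leq_mul2r lekd orbT.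
have le1 : ka * (2 * x0.-1 - y1) = 2 * (ka * x0.-1) - ka * y1 by rewrite mulnBr; lia.
have le2 : d * (2 * x0.-1 - y1) = 2 * (d * x0.-1) - d * y1 by rewrite mulnBr; lia.
have le3 : d * d.-1 <= d * y1 by rewrite leq_mul2l; lia.
have le4 : d * x0.-1 <= d * xu.-1 by rewrite leq_mul2l; lia.
have le5 : d * y1 <= d * (2 * x0.-1) by rewrite leq_mul2l ley orbT.
rewrite (mulnC xu.-1); lia.
Qed.

Lemma bdeg_X x : x \in U -> x \in X -> bdeg x <= t + en + ka ^ 2.
Proof.
move=> xU xX; apply: (@leq_trans (#|L 2 x| + #|L 0 x|)).
  apply: leq_trans (leq_card_setU _ _); apply: subset_leq_card.
  apply/subsetP => p; rewrite link_N // /ctype xX in_setU => /andP[pl pt].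
  case/or3P: (link_cases pl) => [->|/=|->]; rewrite ?orbT //.
  by rewrite inE (negPf pt) andbF.
apply: leq_add; first exact: card_L2_X.
apply: leq_trans (_ : #|[set A : {set V} | A \subset sparseY x & #|A| == 2]| <= _).
  apply: subset_leq_card; apply/subsetP => p pl; rewrite inE (L0_sparseY xX pl).
  by have [_ ->] := ltype_link pl.
rewrite cards_draws; apply: leq_trans (leq_bin2l 2 (ltnW (card_sparseY xU xX))) _.
have := bin2_double ka; nia.
Qed.

Lemma bdeg_z' w : w \in U -> bdeg w <= th_z' th.
Proof.
move=> wU; case: (boolP (w \in X)) => wX.
  exact: leq_trans (bdeg_X wU wX) (th_z'X th).
exact: leq_trans (bdeg_Y wU wX) (th_z'Y th).
Qed.

Lemma card_N_X x : x \in U -> x \in X -> #|XU|.-1 * #|YU| <= #|N x|.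
Proof.
move=> xU xX; rewrite -(card_XUD1 xU xX) -(card_mixed_pairs xX) //.
by apply: subset_leq_card; apply: mixed_pairs_N.
Qed.

(** A link with few pairs is itself bad: it is nearly contained in the empty set, which is [free1]
    with S the whole vertex set. *)
Lemma consistent_link_large w : w \in U -> th_t1' th + n <= #|L (ctype X w) w|.
Proof.
move=> wU; rewrite leqNgt; apply: (contraNN _ (nobad wU)) => lt1.
have E : free1 X U w [set: V] = set0.
  by apply/setP => p; rewrite !inE subsetT !andbF.
apply: (net_gain_bad (in_free1 w setT) _ _ (th_ok7 th)).
  apply: (@leq_trans (#|L (ctype X w) w| + bdeg w)); last first.
    by apply: leq_add (ltnW lt1) (bdeg_z' wU).
  apply: leq_trans (leq_card_setU _ _); apply: subset_leq_card.
  apply/subsetP => p; rewrite in_setD in_setU link_N // => /andP[_ pl].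
  by rewrite pl inE pl; case: eqP.
rewrite E cards0 add0n; case: (boolP (w \in X)) => wX.
  apply: leq_trans (th_xy7 th) (leq_trans _ (card_N_X wU wX)).
  by apply: leq_mul => //; move: lex0; case: x0 #|XU| => [|m] [|k].
by rewrite card_N_Y //; apply: leq_trans (th_x7 th) (leq_bin2l _ lex0).
Qed.

(** Second round of [same_side_bad]: [bdeg_z'] and [consistent_link_large] supply its hypotheses at
    every vertex, so no exceptional triple is left. *)
Lemma same_side_free v b c : [set v; b; c] \in H -> (b \in X) = (c \in X) ->
  ctype X v = ctype X b -> False.
Proof.
move=> vbcH bc vb.
have [vU bU cU] : [/\ v \in U, b \in U & c \in U].
  by split; apply: (H_in HU vbcH); rewrite !inE eqxx ?orbT.
have := consistent_link_large vU; rewrite vb => le1.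
have := same_side_bad HU T5H vbcH bc (bdeg_z' bU) (bdeg_z' cU) le1 (th_ok8 th) (th_ok9 th).
by rewrite !(negPf (nobad _)).
Qed.

Lemma inconsistent_mixed e : e \in inconsistent X H -> #|e :&: X| = 1.
Proof.
rewrite inE => /andP[eH]; have := cardsID X e; have e3 := H_card HU eH; rewrite e3.
move=> e3' e2; have [v ve] : exists v, v \in e by apply/card_gt0P; rewrite e3.
move: (e3); rewrite (cardsD1 v) ve => -[/eqP/cards2P[b [c [_ ebc]]]].
have eE : e = [set v; b; c] by rewrite -edge_of_link -ebc setD1K.
have [be ce] : b \in e /\ c \in e by rewrite eE !inE !eqxx !orbT.
have vbcH : [set v; b; c] \in H by rewrite -eE.
case E : #|e :&: X| e2 e3' => [|[|[|k]]] // _.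
  move/eqP: E; rewrite cards_eq0 => /eqP/setP E _; exfalso.
  have eX u : u \in e -> (u \in X) = false by move=> ue; have := E u; rewrite !inE ue.
  by apply: (same_side_free vbcH); rewrite /ctype ?eX.
move=> e3'; have {e3'} /eqP : #|e :\: X| = 0 by lia.
rewrite cards_eq0 setD_eq0 => /subsetP eX; exfalso.
by apply: (same_side_free vbcH); rewrite /ctype ?eX.
Qed.

End NoBadVertex.

(** * Hypergraphs whose inconsistent triples have sparse mixed pairs *)

Lemma leq_bin_exp (N q : nat) : 'C(N, q) <= N ^ q.
Proof.
elim: N q => [|N IH] [|q] //; rewrite binS.
apply: leq_trans (leq_add (IH _) (IH _)) _.
have le1 : N ^ q <= N.+1 ^ q by case: q => // q; rewrite leq_exp2r.
by rewrite !expnS mulSn addnC leq_add // leq_mul2l le1 orbT.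
Qed.

Section MixedSparse.

Variables (V : finType) (X U : {set V}).
Implicit Types (H : {set {set V}}) (S p e : {set V}) (a b c u v w x y : V).
Implicit Types Q : {set V * V}.

Local Notation n := #|V|.
Local Notation XU := (U :&: X).
Local Notation YU := (U :\: X).

(** By [mixed_edge], it contains all inconsistent triples of a [mixed_sparse] hypergraph whose
    [mixed_pairs] is Q. The two-element sets coming from c = ab.2 do no harm in an upper bound. *)
Definition triples_in Q : {set {set V}} :=
  \bigcup_(ab in Q) [set [set ab.1; ab.2; c] | c : V & (ab.1, c) \in Q].

Definition ctriples_on Q : {set {set V}} :=
  [set e in ctriples X U | [exists ab in Q, (ab.1 \in e) && (ab.2 \in e)]].

Definition mixed_pairs H : {set V * V} :=
  [set ab : V * V | [&& ab.1 \in X, ab.2 \notin X &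
     [exists c, (c \notin X) && ([set ab.1; ab.2; c] \in H)]]].

Lemma card_triples_in Q ka : (forall a, #|[set b | (a, b) \in Q]| <= ka) ->
  #|triples_in Q| <= #|Q| * ka.
Proof.
move=> row; apply: leq_trans (leq_card_bigcup _ _) _.
rewrite -sum_nat_const; apply: leq_sum => -[a b] _ /=.
apply: leq_trans (leq_imset_card _ _) (leq_trans _ (row a)).
by apply: subset_leq_card; apply/subsetP => c; rewrite !inE.
Qed.

Lemma card_edges_through H a b : H \subset triples U -> a \in X -> b \notin X ->
  #|[set e in H | [&& #|e :&: X| == 2, a \in e & b \in e]]| <= pdeg X H a b.
Proof.
move=> HU aX bX; apply: leq_trans (leq_imset_card (fun u => [set a; b; u]) _).
apply: subset_leq_card; apply/subsetP => e; rewrite inE => /and4P[eH e2 ae be].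
have [eU /eqP e3] : e \subset U /\ #|e| == 3.
  by have := subsetP HU _ eH; rewrite inE => /andP.
move: (e2); rewrite (cardsD1 a) inE ae aX eqSS => /cards1P[u uE].
have := set11 u; rewrite -uE !inE => /and3P[ua ue uX].
have E : e = [set a; b; u].
  apply/eqP; rewrite eq_sym eqEcard e3 !subUset !sub1set ae be ue /=.
  rewrite -setUA cardsU1 cards2 !inE negb_or eq_sym (eq_sym a u) ua andbT.
  have -> : b != a by apply: contraNneq bX => ->.
  by have -> : b != u by apply: contraNneq bX => ->.
by apply/imsetP; exists u => //; rewrite inE uX -E.
Qed.

Lemma card_ctriples_on_leq Q : (forall ab, ab \in Q -> ab.1 \in X /\ ab.2 \notin X) ->
  #|ctriples_on Q| <= #|Q| * n.
Proof.
move=> QX; rewrite -sum_nat_const.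
apply: leq_trans (_ : #|\bigcup_(ab in Q) [set e in ctriples X U |
   [&& #|e :&: X| == 2, ab.1 \in e & ab.2 \in e]]| <= _).
  apply: subset_leq_card; apply/subsetP => e; rewrite inE => /andP[eC].
  case/exists_inP => ab abQ /andP[ae be]; apply/bigcupP; exists ab => //.
  by rewrite inE eC ae be !andbT; move: eC; rewrite inE => /andP[].
apply: leq_trans (leq_card_bigcup _ _) _; apply: leq_sum => ab /QX[aX bX].
by apply: leq_trans (card_edges_through (ctriples_sub X U) aX bX) (max_card _).
Qed.

(** For (a, b) in Q and u in X with (u, b) not in Q, the triple abu determines (a, b, u): b is its
    only vertex outside X, and a is the one paired with b in Q. The excluded u number at most ka for
    each pair. *)
Lemma card_ctriples_on_geq Q ka :
  (forall ab, ab \in Q -> [/\ ab.1 \in XU & ab.2 \in YU]) ->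
  (forall b, #|[set a | (a, b) \in Q]| <= ka) ->
  #|Q| * #|XU| <= #|ctriples_on Q| + #|Q| * ka.
Proof.
move=> QX col; rewrite -cardsX -(cardsID [set t : V * V * V | (t.2, t.1.2) \in Q]) addnC.
apply: leq_add; last first.
  apply: leq_trans (@leq_card_fiber _ _ fst _ Q ka _ _) _ => //.
    by move=> t; rewrite !inE => /andP[/andP[]].
  move=> ab abQ; apply: leq_trans (col ab.2); apply: (@leq_card_inj _ _ snd).
    move=> [t1 u1] [t2 u2]; rewrite !inE /= => /andP[_ /eqP ->] /andP[_ /eqP ->].
    by move=> ->.
  by move=> t; rewrite !inE => /andP[/andP[_ h] /eqP <-].
pose f (t : V * V * V) := [set t.1.1; t.1.2; t.2].
apply: (@leq_card_inj _ _ f).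
  move=> [[a b] u] [[a' b'] u']; rewrite /f !in_setD !in_setX !inE /=.
  move=> /and3P[ubQ abQ /andP[uU uX]] /and3P[ubQ' abQ' /andP[uU' uX']] /setP E.
  have [/setIP[aU aX] /setDP[bU bX]] := QX _ abQ.
  have [/setIP[aU' aX'] /setDP[bU' bX']] := QX _ abQ'.
  have bb : b = b'.
    have := E b; rewrite !inE eqxx orbT /= => /esym/orP[/orP[/eqP h|/eqP//]|/eqP h].
      by rewrite h aX' in bX.
    by rewrite h uX' in bX.
  subst b'.
  have aa : a = a'.
    have := E a; rewrite !inE eqxx /= => /esym/orP[/orP[/eqP//|/eqP h]|/eqP h].
      by rewrite -h aX in bX.
    by rewrite -h abQ in ubQ'.
  subst a'; have := E u; rewrite !inE eqxx orbT => /esym/orP[/orP[/eqP h|/eqP h]|/eqP-> //].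
    by rewrite h abQ in ubQ.
  by rewrite -h uX in bX.
move=> [[a b] u]; rewrite /f in_setD !in_setX !inE /=.
move=> /and3P[ubQ abQ /andP[uU uX]].
have [/setIP[aU aX] /setDP[bU bX]] := QX _ abQ.
have ab : a != b by apply: contraNneq bX => <-.
have ub : u != b by apply: contraNneq bX => <-.
have au : a != u by apply: contraNneq ubQ => <-.
rewrite !subUset !sub1set aU bU uU -setUA cardsU1 cards2 !inE negb_or ab au (eq_sym b) ub /=.
apply/andP; split; last by apply/existsP; exists (a, b); rewrite abQ !inE !eqxx ?orbT.
rewrite (_ : _ :&: X = [set a; u]) ?cards2 ?au //.
apply/setP => v; rewrite !inE; case: (eqVneq v a) => [->|va] /=; first by rewrite aX.
case: (eqVneq v u) => [->|vu] /=; first by rewrite uX orbT.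
by rewrite orbF; case: eqP => // ->; rewrite (negPf bX).
Qed.

Variables (mu ka : nat).

Definition mixed_sparse H : Prop :=
  [/\ H \subset triples U,
      forall e, e \in inconsistent X H -> #|e :&: X| = 1,
      forall x b c, x \in X -> b \notin X -> c \notin X -> [set x; b; c] \in H ->
        pdeg X H x b < mu,
      forall x, x \in XU -> #|sparseY X U H mu x| <= ka &
      forall y, y \in YU -> #|sparseX X U H mu y| <= ka].

Lemma mixed_pairsP H : mixed_sparse H -> forall ab, ab \in mixed_pairs H ->
  [/\ ab.1 \in XU, ab.2 \in YU & pdeg X H ab.1 ab.2 < mu].
Proof.
move=> [HU _ Hmu _ _] [a b]; rewrite inE => /and3P[/= aX bX /existsP[c /andP[cX abcH]]].
rewrite !inE aX bX (Hmu a b c) //=.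
by rewrite !(H_in HU abcH) // !inE eqxx ?orbT.
Qed.

Lemma mixed_pairs_row H a : mixed_sparse H -> #|[set b | (a, b) \in mixed_pairs H]| <= ka.
Proof.
move=> HS; case: (set_0Vmem [set b | (a, b) \in mixed_pairs H]) => [->|[b0]].
  by rewrite cards0.
rewrite inE => /(mixed_pairsP HS)[aX _ _]; have [_ _ _ + _] := HS => /(_ _ aX).
apply: leq_trans; apply: subset_leq_card; apply/subsetP => b; rewrite inE.
by move=> /(mixed_pairsP HS)[/= _ bY lt]; rewrite inE bY.
Qed.

Lemma mixed_pairs_col H b : mixed_sparse H -> #|[set a | (a, b) \in mixed_pairs H]| <= ka.
Proof.
move=> HS; case: (set_0Vmem [set a | (a, b) \in mixed_pairs H]) => [->|[a0]].
  by rewrite cards0.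
rewrite inE => /(mixed_pairsP HS)[_ bX _]; have [_ _ _ _ +] := HS => /(_ _ bX).
apply: leq_trans; apply: subset_leq_card; apply/subsetP => a; rewrite inE.
by move=> /(mixed_pairsP HS)[/= aX _ lt]; rewrite inE aX.
Qed.

Lemma mixed_edge H e : mixed_sparse H -> e \in inconsistent X H ->
  exists a b c, [/\ e = [set a; b; c], b != c, (a, b) \in mixed_pairs H &
                    (a, c) \in mixed_pairs H].
Proof.
move=> [HU H1 _ _ _] eI; have e1 := H1 e eI; move: eI; rewrite inE => /andP[eH _].
have e3 := H_card HU eH; have := cardsID X e; rewrite e1 e3 => -[/eqP/cards2P[b [c [bc bcE]]]].
move/eqP/cards1P: e1 => [a aE].
have eE : e = [set a; b; c] by rewrite -(setID e X) aE bcE setUA.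
have aX : a \in X by have := set11 a; rewrite -aE inE => /andP[].
have bX : b \notin X by have := set21 b c; rewrite -bcE inE => /andP[].
have cX : c \notin X by have := set22 b c; rewrite -bcE inE => /andP[].
exists a, b, c; split=> //; rewrite inE /= aX ?bX ?cX /=; apply/existsP.
  by exists c; rewrite cX -eE.
by exists b; rewrite bX setUAC -eE.
Qed.

(* The q = #|Q| sparse pairs cost about q |X| consistent triples, while the
   triples spanned by [Q] bring at most q ka new ones. *)
Lemma card_mixed_sparse_at (F : {set {set {set V}}}) Q t r d :
  0 < t -> t * mu + 2 * (n %/ 2 ^ t) + 4 <= r -> d + 2 * ka + r <= #|XU| -> 0 < #|Q| ->
  (forall H, H \in F -> mixed_sparse H) ->
  #|[set H in F | mixed_pairs H == Q]| * 2 ^ (#|Q| * d) <= 2 ^ #|ctriples X U|.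
Proof.
move=> t0 ler led Q0 FS.
case: (set_0Vmem [set H in F | mixed_pairs H == Q]) => [->|[H0]]; first by rewrite cards0.
rewrite inE => /andP[/FS HS0 /eqP QE0].
(* Each pair of Q lies in fewer than mu consistent edges of H, so all but [#|Q| * mu] edges of H lie
   in M. *)
pose M := (ctriples X U :\: ctriples_on Q) :|: triples_in Q.
pose O := M :|: ctriples_on Q.
have QX ab : ab \in Q -> [/\ ab.1 \in XU & ab.2 \in YU].
  by rewrite -QE0 => /(mixed_pairsP HS0)[].
have QX' ab : ab \in Q -> ab.1 \in X /\ ab.2 \notin X.
  by case/QX; rewrite !inE => /andP[_ ->] /andP[->].
have row a : #|[set b | (a, b) \in Q]| <= ka by rewrite -QE0 mixed_pairs_row.
have col b : #|[set a | (a, b) \in Q]| <= ka by rewrite -QE0 mixed_pairs_col.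
have leF : #|[set H in F | mixed_pairs H == Q]| <= 2 ^ #|M| * binsum (#|Q| * n) (#|Q| * mu).
  apply: leq_trans (_ : _ <= #|[set L : {set {set V}} | (L \subset O) &&
     (#|L :\: M| <= #|Q| * mu)]|) _.
    apply: subset_leq_card; apply/subsetP => H; rewrite inE => /andP[/FS HS /eqP QE].
    have [HU _ _ _ _] := HS.
    have HO : H \subset O.
      apply/subsetP => e eH; case: (boolP (e \in inconsistent X H)) => [eI|].
        have [a [b [c [-> _ abQ acQ]]]] := mixed_edge HS eI.
        apply/setUP; left; apply/setUP; right; apply/bigcupP; exists (a, b).
          by rewrite -QE.
        by apply/imsetP; exists c; rewrite // inE -QE.
      rewrite inE eH negbK /= => e2; have eC : e \in ctriples X U.
        by rewrite inE e2 (subsetP HU).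
      by rewrite !in_setU in_setD eC andbT; case: (e \in ctriples_on Q); rewrite ?orbT.
    rewrite inE HO /=; rewrite -sum_nat_const.
    apply: leq_trans (_ : #|\bigcup_(ab in Q) [set e in H |
       [&& #|e :&: X| == 2, ab.1 \in e & ab.2 \in e]]| <= _).
      apply: subset_leq_card; apply/subsetP => e /setDP[eH eM].
      have := subsetP HO _ eH; rewrite in_setU (negPf eM) /= inE => /andP[eC].
      case/exists_inP => ab abQ /andP[ae be]; apply/bigcupP; exists ab => //.
      by rewrite inE eH ae be !andbT; move: eC; rewrite inE => /andP[].
    apply: leq_trans (leq_card_bigcup _ _) _; apply: leq_sum => ab abQ.
    have [aX bX] := QX' _ abQ; apply: leq_trans (card_edges_through HU aX bX) _.
    by rewrite -QE in abQ; have [_ _ /ltnW] := mixed_pairsP HS abQ.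
  apply: leq_trans (card_nearly_contained _ _ _) _.
  rewrite leq_mul2l leq_binsum ?orbT //.
  apply: leq_trans (card_ctriples_on_leq QX'); apply: subset_leq_card.
  by apply/subsetP => e /setDP[/setUP[->//|]].
(* One [#|Q| * ka] bounds [triples_in Q], the other is the loss in [card_ctriples_on_geq]. *)
have leM : #|M| + #|Q| * #|XU| <= #|ctriples X U| + 2 * (#|Q| * ka).
  have := card_ctriples_on_geq QX col; have := card_triples_in row.
  have le1 : #|M| <= #|ctriples X U :\: ctriples_on Q| + #|triples_in Q|.
    exact: leq_card_setU.
  have sub : ctriples_on Q \subset ctriples X U.
    by apply/subsetP => e; rewrite inE => /andP[].
  have := subset_leq_card sub; move: le1; rewrite cardsDS //; lia.
have leB : binsum (#|Q| * n) (#|Q| * mu) <= 2 ^ (#|Q| * r).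
  apply: leq_trans (binsum_leq _ _ t0) _; rewrite leq_exp2l //.
  have : #|Q| * n %/ 2 ^ t <= #|Q| * (n %/ 2 ^ t).+1.
    apply: ltnW; rewrite ltn_divLR ?expn_gt0 // -mulnA ltn_pmul2l //.
    by rewrite ltn_ceil ?expn_gt0.
  by have : #|Q| * (t * mu + 2 * (n %/ 2 ^ t) + 4) <= #|Q| * r; [rewrite leq_mul2l ler orbT|nia].
apply: leq_trans (leq_mul leF (leqnn _)) _.
apply: leq_trans (leq_mul (leq_mul (leqnn _) leB) (leqnn _)) _.
rewrite -!expnD leq_exp2l //.
have : #|Q| * (d + 2 * ka + r) <= #|Q| * #|XU| by rewrite leq_mul2l led orbT.
by rewrite !mulnDr; lia.
Qed.

(* An inconsistent triple abc has two sparse pairs, so #|Q| >= 2; since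
   2 |X| is about 4n/3, this beats the number 2^n of partitions. *)
Lemma card_mixed_sparse (F : {set {set {set V}}}) t r l d :
  0 < t -> t * mu + 2 * (n %/ 2 ^ t) + 4 <= r -> l + d + 2 * ka + r <= #|XU| ->
  n ^ 2 <= 2 ^ l ->
  (forall H, H \in F -> mixed_sparse H /\ inconsistent X H != set0) ->
  #|F| * 2 ^ (2 * d) <= (n ^ 2).+1 * 2 ^ #|ctriples X U|.
Proof.
move=> t0 ler led leN FS.
have card_Q H : H \in F -> 1 < #|mixed_pairs H|.
  move=> /FS[HS /set0Pn[e eI]]; have [a [b [c [_ bc abQ acQ]]]] := mixed_edge HS eI.
  apply/card_gt1P; exists (a, b), (a, c); split=> //.
  by apply: contraNneq bc => -[->].
have card_P : #|{: V * V}| = n ^ 2 by rewrite card_prod.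
rewrite -sum1_card (partition_big (fun H => inord #|mixed_pairs H| : 'I_(n ^ 2).+1) xpredT) //=.
rewrite big_distrl; apply: (@leq_trans (\sum_(q < (n ^ 2).+1) 2 ^ #|ctriples X U|)); last first.
  by rewrite sum_nat_const card_ord.
apply: leq_sum => q _ /=.
case: (leqP q 1) => q1.
  rewrite big_pred0 // => H; apply/negP => /andP[HF /eqP E]; have := card_Q H HF.
  move: q1; rewrite -E inordK; first by move=> h; rewrite ltnNge h.
  by rewrite ltnS -card_P max_card.
rewrite (partition_big mixed_pairs (fun Q => #|Q| == q)) /=; last first.
  by move=> H /andP[_ /eqP <-]; rewrite inordK // ltnS -card_P max_card.
set S := \sum_(Q | _) _.
(* There are at most n^(2q) <= 2^(l q) sets Q of size q, so l of the l + d saved per pair pays for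
   the choice of Q. *)
have leS : S * 2 ^ (q * (l + d)) <= 2 ^ (l * q) * 2 ^ #|ctriples X U|.
  apply: (@leq_trans ('C(#|{: V * V}|, q) * 2 ^ #|ctriples X U|)); last first.
    by rewrite leq_mul2r card_P (leq_trans (leq_bin_exp _ _)) ?orbT // expnM
       leq_exp2r // ltnW.
  apply: (@leq_trans (\sum_(Q in [set Q : {set V * V} | #|Q| == q]) 2 ^ #|ctriples X U|)).
    rewrite big_distrl /= [leqRHS](eq_bigl (fun Q : {set V * V} => #|Q| == q)); last first.
      by move=> Q; rewrite inE.
    apply: leq_sum => Q /eqP Qq; rewrite sum1dep_card.
    apply: leq_trans (@card_mixed_sparse_at F Q t r (l + d) t0 ler led _ _).
    - rewrite Qq leq_mul2r; apply/orP; right; apply: subset_leq_card; apply/subsetP => H.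
      by rewrite !inE => /andP[/andP[-> _] ->].
    - by rewrite Qq ltnW.
    by move=> H /FS[].
  by rewrite sum_nat_const card_draws.
have : S * 2 ^ (q * d) <= 2 ^ #|ctriples X U|.
  rewrite -(@leq_pmul2l (2 ^ (l * q))) ?expn_gt0 // mulnCA -expnD.
  by rewrite (_ : l * q + q * d = q * (l + d)) //; lia.
apply: leq_trans; rewrite leq_mul2l leq_exp2l // leq_mul2r q1 !orbT //.
Qed.

End MixedSparse.

(** * Iterating the deletion *)

Lemma has_copyS (V W : finType) (F : {set {set V}}) (H1 H2 : {set {set W}}) :
  H1 \subset H2 -> has_copy F H1 -> has_copy F H2.
Proof.
move=> sH /existsP[f /andP[injf /forall_inP fF]]; apply/existsP; exists f.
by rewrite injf; apply/forall_inP => e /fF /(subsetP sH).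
Qed.

Section Recursion.

Variables (V : finType) (X : {set V}) (I : nat).
Implicit Types (H : {set {set V}}) (S p e U : {set V}) (a b c u v w x y : V).

Local Notation n := #|V|.

Lemma card_triples_leq U : #|triples U| <= n ^ 3.
Proof.
rewrite cards_draws; apply: leq_trans (leq_bin_exp _ _) _.
by rewrite leq_exp2r // max_card.
Qed.

(* Optimality of the partition for a hypergraph obtained by deleting [n - #|U|] vertices. *)
Definition almost_optimal U H : bool :=
  [forall v, if v \in X then #|ltype X H v 2| <= #|ltype X H v 1| + (n - #|U|) * n
             else #|ltype X H v 1| <= #|ltype X H v 2| + (n - #|U|) * n].

Definition T5_family U : {set {set {set V}}} :=
  [set H : {set {set V}} | [&& H \subset triples U, ~~ has_copy T5 H,
     #|inconsistent X H| <= I & almost_optimal U H]].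

Lemma T5_familyP U H : H \in T5_family U ->
  [/\ H \subset triples U, ~~ has_copy T5 H, #|inconsistent X H| <= I & almost_optimal U H].
Proof. by rewrite inE => /and4P. Qed.

Lemma T5_family_triples U H : H \in T5_family U -> H \subset triples U.
Proof. by case/T5_familyP. Qed.

Lemma ltype_delv U H v w j : H \subset triples U ->
  #|ltype X (delv H w) v j| <= #|ltype X H v j|
  /\ (v != w -> #|ltype X H v j| <= #|ltype X (delv H w) v j| + n).
Proof.
move=> HU; split=> [|vw].
  apply: subset_leq_card; apply/subsetP => p; rewrite !inE.
  by case/andP=> /andP[-> /andP[-> _]] ->.
apply: leq_trans (@card_pairs_avoiding _ _ w _) _.
  by move=> p; rewrite inE => /andP[/(link_pair HU)[]].
rewrite leq_add2r; apply: subset_leq_card; apply/subsetP => p; rewrite !inE.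
by case/andP=> /andP[/andP[-> ->] ->] wp; rewrite negb_or eq_sym vw wp.
Qed.

Lemma ltype_delv0 H w j : ltype X (delv H w) w j = set0.
Proof. by apply/setP => p; rewrite !inE eqxx !andbF. Qed.

(** Deleting w removes at most n pairs from the link of any other vertex, and the error in
    [almost_optimal] grows by exactly n. *)
Lemma T5_family_delv U H w :
  H \in T5_family U -> w \in U -> delv H w \in T5_family (U :\ w).
Proof.
move=> /T5_familyP[HU T5H HI opt] wU; rewrite inE; apply/and4P; split.
- by rewrite -delv_triples delvS.
- by apply: contra T5H; apply: has_copyS (delv_sub H w).
- apply: leq_trans HI; apply: subset_leq_card; apply/subsetP => e.
  by rewrite !inE => /andP[/andP[-> _] ->].
apply/forallP => v; case: (eqVneq v w) => [->|vw].
  by rewrite !ltype_delv0 cards0; case: ifP.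
have nE : (n - #|U :\ w|) * n = (n - #|U|) * n + n.
  have := max_card (mem U); rewrite (cardsD1 w U) wU; nia.
have := forallP opt v; rewrite nE; case: ifP => _ le.
  have [le1 _] := ltype_delv v w 2 HU; have [_ /(_ vw) le2] := ltype_delv v w 1 HU; lia.
have [le1 _] := ltype_delv v w 1 HU; have [_ /(_ vw) le2] := ltype_delv v w 2 HU; lia.
Qed.

Lemma card_T5_family_crude U : #|T5_family U| <= binsum (n ^ 3) I * 2 ^ #|ctriples X U|.
Proof.
apply: leq_trans (_ : _ <= #|[set H : {set {set V}} | (H \subset triples U) &&
   (#|H :\: ctriples X U| <= I)]|) _.
  apply: subset_leq_card; apply/subsetP => H /T5_familyP[HU _ HI _]; rewrite inE HU.
  apply: leq_trans HI; apply: subset_leq_card; apply/subsetP => e.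
  rewrite in_setD [e \in ctriples _ _]inE [e \in inconsistent _ _]inE negb_and.
  by case/andP=> h eH; move: h; rewrite eH (subsetP HU) //=.
apply: leq_trans (card_nearly_contained _ _ _) _; rewrite mulnC leq_mul2r.
rewrite leq_binsum ?orbT //; apply: leq_trans (card_triples_leq U).
exact: subset_leq_card (subsetDl _ _).
Qed.

Variables (g K x0 y0 y1 mu ka : nat).
Variable th : thresholds n g I (K * n) x0 y0 y1 mu ka.
Hypothesis lex0 : x0 + K <= #|X|.
Hypothesis ley0 : y0 + K <= #|~: X|.
Hypothesis ley1 : #|~: X| <= y1.

Lemma no_bad_mixed_sparse U H : n <= #|U| + K -> H \in T5_family U ->
  ~~ [exists w in U, bad X g U H w] -> mixed_sparse X U mu ka H.
Proof.
move=> leU /T5_familyP[HU T5H HI opt] /exists_inPn nb.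
have leK : (n - #|U|) * n <= K * n by rewrite leq_mul2r leq_subLR leU orbT.
have optX x : x \in X -> #|ltype X H x 2| <= #|ltype X H x 1| + K * n.
  by move=> xX; have := forallP opt x; rewrite xX; lia.
have optY y : y \notin X -> #|ltype X H y 1| <= #|ltype X H y 2| + K * n.
  by move=> yX; have := forallP opt y; rewrite (negPf yX); lia.
have cU : #|~: U| <= K by have := cardsC U; lia.
have lex : x0 <= #|U :&: X|.
  have := cardsID U X; rewrite setIC.
  have : #|X :\: U| <= #|~: U| by rewrite subset_leq_card // setDE subsetIr.
  lia.
have ley : y0 <= #|U :\: X|.
  have := cardsID U (~: X); rewrite [~: X :&: U]setIC -setDE.
  have : #|~: X :\: U| <= #|~: U| by rewrite subset_leq_card // setDE subsetIr.
  lia.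
have ley' : #|U :\: X| <= y1.
  by apply: leq_trans ley1; rewrite subset_leq_card // setDE subsetIr.
split=> //.
- exact: (inconsistent_mixed th HU T5H HI optX optY lex ley ley' nb).
- exact: (sparse_pair th HU T5H HI optY lex ley ley' nb).
- by move=> x /setIP[xU xX]; apply/ltnW/(card_sparseY th HU T5H HI optX optY lex ley ley' nb).
by move=> y /setDP[yU yX]; apply/ltnW/(card_sparseX th HU T5H HI optY lex ley ley' nb).
Qed.

Variables (t r l d : nat).
Hypothesis t_gt0 : 0 < t.
Hypothesis ler : t * mu + 2 * (n %/ 2 ^ t) + 4 <= r.
Hypothesis led : l + d + 2 * ka + r <= x0.
Hypothesis lel : n ^ 2 <= 2 ^ l.

Lemma card_no_bad_inconsistent U : n <= #|U| + K ->
  #|[set H in T5_family U | ~~ [exists w in U, bad X g U H w] & inconsistent X H != set0]|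
    * 2 ^ (2 * d) <= (n ^ 2).+1 * 2 ^ #|ctriples X U|.
Proof.
move=> leU; apply: (@card_mixed_sparse _ _ _ mu ka _ t r l) => //.
  apply: leq_trans led _; have cU : #|~: U| <= K by have := cardsC U; lia.
  have := cardsID U X; rewrite setIC.
  have : #|X :\: U| <= #|~: U| by rewrite subset_leq_card // setDE subsetIr.
  lia.
move=> H; rewrite inE => /and3P[HT nb ->]; split=> //.
exact: no_bad_mixed_sparse nb.
Qed.

Variables (g' s : nat).
Hypothesis leg : n * (3 * 2 ^ n + n ^ 2) * 2 ^ g' <= 2 ^ g.
Hypothesis g'_gt1 : 1 < g'.
Hypothesis les : (n ^ 2).+1 <= 2 ^ (2 * d).
Hypothesis leI : binsum (n ^ 3) I <= 2 ^ s.

Lemma card_some_bad_gain U R m :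
  (forall w, w \in U -> #|T5_family (U :\ w)| * m <= R * 2 ^ #|ctriples X (U :\ w)|) ->
  #|[set H in T5_family U | [exists w in U, bad X g U H w]]| * 2 ^ g' * m
    <= R * 2 ^ #|ctriples X U|.
Proof.
move=> leR; have := card_some_bad_leq g T5_family_triples T5_family_delv leR.
set a := #|_|; set E := 2 ^ #|_| => le1.
rewrite -(leq_pmul2l (_ : 0 < 2 ^ g)) ?expn_gt0 //.
apply: leq_trans (_ : a * 2 ^ g * m * 2 ^ g' <= _); first by lia.
apply: leq_trans (leq_mul le1 (leqnn _)) _.
apply: leq_trans (leq_mul leg (leqnn (R * E))); lia.
Qed.

Lemma card_consistent_family U :
  #|[set H in T5_family U | inconsistent X H == set0]| <= 2 ^ #|ctriples X U|.
Proof.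
rewrite -card_powerset; apply: subset_leq_card; apply/subsetP => H.
rewrite inE => /andP[/T5_family_triples HU /eqP/setP I0]; rewrite inE.
apply/subsetP => e eH; rewrite inE (subsetP HU) //=.
by have := I0 e; rewrite !inE eH /= => /negbFE.
Qed.

(* Each deletion gains a factor 2^g', so [K] of them absorb the crude bound 2^s
   on the choices of the inconsistent triples. *)
Lemma card_T5_family U j : #|U| + K = n + j ->
  #|T5_family U| * 2 ^ (j * g') <= (3 * 2 ^ (j * g') + 2 ^ s) * 2 ^ #|ctriples X U|.
Proof.
elim: j U => [|j IH] U cU.
  rewrite mul0n muln1; apply: leq_trans (card_T5_family_crude U) _.
  by rewrite leq_mul2r (leq_trans leI) ?orbT // leq_addl.
pose R := 3 * 2 ^ (j * g') + 2 ^ s.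
have {}IH w : w \in U -> #|T5_family (U :\ w)| * 2 ^ (j * g') <= R * 2 ^ #|ctriples X (U :\ w)|.
  by move=> wU; apply: IH; move: cU; rewrite (cardsD1 w) wU; lia.
have := card_some_bad_gain IH; have := card_consistent_family U.
have leU : n <= #|U| + K by rewrite cU leq_addr.
have := card_no_bad_inconsistent leU.
set B := [set H in _ | _ & _]; set C := [set H in _ | _]; set A := [set H in _ | _].
set E := 2 ^ #|ctriples X U| => leB leC leA.
have {}leB : #|B| <= E.
  rewrite -(leq_pmul2r (_ : 0 < 2 ^ (2 * d))) ?expn_gt0 //.
  by apply: leq_trans leB _; rewrite mulnC leq_mul2l les orbT.
have leT : #|T5_family U| <= #|A| + #|B| + #|C|.
  apply: leq_trans (leq_add (leq_card_setU A B) (leqnn _)).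
  apply: leq_trans (leq_card_setU _ _); apply: subset_leq_card.
  apply/subsetP => H HT; rewrite in_setU in_setU [H \in A]inE [H \in B]inE [H \in C]inE HT /=.
  by case: [exists w in U, _]; case: eqP.
move: leA; rewrite /R mulSn expnD; set G := 2 ^ g'; set m := 2 ^ (j * g') => leA.
(* The coefficient 3 reproduces itself: B and C contribute at most 1 each, and A at most 3 / G <= 1
   besides the crude term. *)
have G4 : 4 <= G by rewrite -[4]/(2 ^ 2) leq_exp2l.
apply: leq_trans (leq_mul leT (leqnn _)) _; rewrite !mulnDl.
have m0 : 0 < m by rewrite expn_gt0.
have h1 : #|B| * (G * m) <= E * (G * m) by rewrite leq_mul2r leB orbT.
have h2 : #|C| * (G * m) <= E * (G * m) by rewrite leq_mul2r leC orbT.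
have h3 : 3 * m * E <= G * m * E by rewrite -!mulnA leq_mul2r ltnW ?orbT.
move: leA; rewrite mulnDl -!mulnA; lia.
Qed.

Hypothesis K_gt0 : 0 < K.
Hypothesis leK : s <= K.-1 * g'.

(** After one deletion, [card_T5_family] with j = K - 1 bounds the ratio by 3 + 1 = 4, and the first
    bad vertex still gains 2 ^ g', at least 4 * 2 ^ q. The consistent hypergraphs, where nothing is
    gained, are left out only at this top level. *)
Lemma card_T5_family_inconsistent q : q + 2 <= g' -> (n ^ 2).+1 * 2 ^ q <= 2 ^ (2 * d) ->
  #|[set H in T5_family [set: V] | inconsistent X H != set0]| * 2 ^ q
    <= 2 * 2 ^ #|ctriples X [set: V]|.
Proof.
move=> leq1 leq2.
have le4 w : w \in [set: V] -> #|T5_family ([set: V] :\ w)| * 1 <= 4 * 2 ^ #|ctriples X ([set: V] :\ w)|.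
  move=> wV; rewrite muln1 -(leq_pmul2r (_ : 0 < 2 ^ (K.-1 * g'))) ?expn_gt0 //.
  apply: leq_trans (card_T5_family _) _; first by have := cardsD1 w setT; rewrite cardsT wV; lia.
  rewrite mulnAC leq_mul2r; apply/orP; right.
  by have : 2 ^ s <= 2 ^ (K.-1 * g'); [rewrite leq_exp2l|lia].
have := card_some_bad_gain le4; have := @card_no_bad_inconsistent [set: V].
rewrite cardsT leq_addr => /(_ isT).
set B := [set H in _ | _ & _]; set A := [set H in _ | _].
set E := 2 ^ #|ctriples X _|; rewrite muln1 => leB leA.
have leT : #|[set H in T5_family [set: V] | inconsistent X H != set0]| <= #|A| + #|B|.
  apply: leq_trans (leq_card_setU _ _); apply: subset_leq_card.
  apply/subsetP => H; rewrite inE => /andP[HT i0].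
  by rewrite in_setU [H \in A]inE [H \in B]inE HT i0 andbT orbN.
have lA : #|A| * 2 ^ q <= E.
  rewrite -(leq_pmul2l (_ : 0 < 4)) //; apply: leq_trans leA.
  rewrite mulnCA leq_mul2l -[4]/(2 ^ 2) -expnD leq_exp2l // addnC leq1 orbT //.
have lB : #|B| * 2 ^ q <= E.
  rewrite -(leq_pmul2l (_ : 0 < (n ^ 2).+1)) //; apply: leq_trans leB.
  by rewrite mulnCA leq_mul2l leq2 orbT.
by apply: leq_trans (leq_mul leT (leqnn _)) _; rewrite mulnDl; lia.
Qed.

End Recursion.

(** * Choice of the parameters *)

(** With t = 8c in [binsum_leq], each of t * s, 2 * (N %/ 2 ^ t) and g + 2 is at most N / (4c), and
    r is at least N / c. The bound 64 * c <= c' keeps the successive scales of [parameters]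
    apart. *)
Lemma net_gain_level (c : nat) : 0 < c -> exists2 c', 64 * c <= c' &
  forall N g s r, N <= c * r -> c' * s <= N -> c' * g.+1 <= N -> net_gain N g s r.
Proof.
move=> c0; exists (64 * c * c); first by rewrite leq_pmulr.
move=> N g s r leN les leg; pose t := 8 * c.
have t0 : 0 < t by rewrite muln_gt0.
rewrite /net_gain; apply: leq_trans (leq_mul (binsum_leq N s t0) (leqnn _)) _.
rewrite -expnD leq_exp2l //.
have q1 : t * (N %/ 2 ^ t) <= N.
  apply: leq_trans (leq_divM N (2 ^ t)); rewrite mulnC leq_mul2l.
  by rewrite (ltnW (ltn_expl t (ltnSn 1))) orbT.
have h1 : 4 * c * (t * s) <= N by apply: leq_trans les; rewrite /t; lia.
have h2 : 8 * c * (N %/ 2 ^ t) <= N by apply: leq_trans q1; rewrite /t.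
have h3 : 4 * c * (g + 2) <= N.
  apply: leq_trans leg; have : c * g.+1 <= c * c * g.+1 by rewrite leq_mul2r leq_pmulr ?orbT.
  lia.
rewrite -(@leq_pmul2l (4 * c)) ?muln_gt0 //; move: h1 h2 h3; set a := t * s; set b := N %/ _.
lia.
Qed.

Lemma floor_div (a b : nat) : 0 < b -> exists2 q, b * q <= a & a < b * q + b.
Proof.
move=> b0; exists (a %/ b); first by rewrite mulnC leq_divM.
by rewrite -mulnSr mulnC ltn_ceil.
Qed.

Lemma sqr_leq_exp (n : nat) : n ^ 2 <= 2 ^ (2 * (n %/ 400) + 18).
Proof.
set k := n %/ 400.
have h1 : n <= 2 ^ 9 * 2 ^ k.
  have h : n < 400 * k.+1 by rewrite mulnC ltn_ceil.
  have h2 : k < 2 ^ k by rewrite ltn_expl.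
  apply: leq_trans (ltnW h) _; apply: leq_mul => //.
by rewrite mulnC (_ : 18 = 9 * 2) // expnD (expnM 2 9) expnM -expnMn mulnC leq_exp2r.
Qed.

(** The scales are fixed from the coarsest to the finest: each use of [net_gain_level] takes a c
    such that the saving in question is at least n^2 / c (n^3 / c for E), and returns the
    denominator of what must be negligible against it. A1, A2, A3 set t1', t2' and z', and A3 also
    ka; B1 sets mu; B2, B3, B4 set t1, t2 and z, B2 also K and B4 also g. *)
Lemma parameters : exists c n0 : nat, forall n I, n0 <= n -> c * I <= n ^ 3 ->
  exists g K mu ka s, 
  [/\ [/\ 0 < K, 100 * K <= n, 1000 * mu <= n & 1000 * ka <= n],
      5 * n + 10 <= g, 
      binsum (n ^ 3) I <= 2 ^ s, 
      s <= K.-1 * (g - (3 * n + 2)) /\ 100 * 100 * s <= n ^ 3 &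
      forall x0 y0 y1, 62 * n <= 100 * x0 -> 29 * n <= 100 * y0 -> 100 * y1 <= 37 * n ->
        x0 <= n -> inhabited (thresholds n g I (K * n) x0 y0 y1 mu ka)].
Proof.
have [A1 leA1 gA1] := @net_gain_level 20 isT.
have [A2 leA2 gA2] := @net_gain_level (5 * A1) ltac:(lia).
have [A3 leA3 gA3] := @net_gain_level (5 * A2) ltac:(lia).
have [B1 leB1 gB1] := @net_gain_level (9 * A3) ltac:(lia).
have B1B2 : B1 <= B1 * B1 by rewrite leq_pmulr //; lia.
have [B2 leB2 gB2] := @net_gain_level (40 * (B1 * B1)) ltac:(lia).
have [B3 leB3 gB3] := @net_gain_level (9 * B2) ltac:(lia).
have [B4 leB4 gB4] := @net_gain_level (5 * B3) ltac:(lia).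
have B24 : 0 < B2 * B4 by rewrite muln_gt0; lia.
(* K - 1 >= n / (80 * B2) and g - (3n + 2) >= n^2 / (8 * B4), so their product exceeds n^3 / D >=
   s. *)
pose D := 80 * 100 * (B2 * B4).
have [E leE gE] := @net_gain_level (2 * D) ltac:(rewrite /D; lia).
(* E serves the bound on [binsum (n ^ 3) I]; the other term gives 3 * I <= K * z, as K >= n / (40 *
   B2) and z >= n^2 / (2 * B4). *)
exists (E + 240 * (B2 * B4)), (1000 * B4 + 2 * D + E); move=> n I len leI.
have nn : 1000 * (B4 * n) <= n * n by rewrite mulnA leq_mul2r; lia.
have mono a : a <= B4 -> 1000 * (a * n) <= n * n.
  by move=> le; apply: leq_trans nn; rewrite leq_mul2l leq_mul2r le !orbT.
have [lA1 lA2 lA3 lB1] : [/\ 1280 <= A1, 320 * A1 <= A2, 320 * A2 <= A3 & 576 * A3 <= B1].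
  by clear -leA1 leA2 leA3 leB1; split; lia.
have [lB2 lB3 lB4] : [/\ 2560 * (B1 * B1) <= B2, 576 * B2 <= B3 & 320 * B3 <= B4].
  by clear -leB2 leB3 leB4; split; lia.
have [g gl gu] := @floor_div (n * n) (2 * B4) ltac:(lia).
have [K Kl Ku] := @floor_div n (20 * B2) ltac:(lia).
have [mu ml mm] := @floor_div n (4 * B1) ltac:(lia).
have [ka kl ku] := @floor_div n (2 * A3) ltac:(lia).
have [s sl su] := @floor_div (n ^ 3) D ltac:(lia).
have B4_gt0 : 0 < B4 by lia.
have lenB : 1000 * B4 <= n by lia.
have B24' : 1 * 1280 <= B2 * B4 by apply: leq_mul; lia.
have nD : D <= n by lia.
have nE : E <= n by lia.
have n3 : n ^ 3 = n * (n * n) by [].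
have n_gt0 : 0 < n by lia.
have nn_gt0 : 0 < n * n by rewrite muln_gt0 n_gt0.
have nn3 : n <= n ^ 3 by rewrite n3 leq_pmulr.
have b4n : B4 <= B4 * n by rewrite leq_pmulr.
have halfK : n <= 40 * (B2 * K).
  clear -Kl Ku lB3 lB4 lB2 lenB. lia.
have Bg : n * n <= 4 * (B4 * g) by lia.
have leg : 100 * n <= g.
  rewrite -(leq_pmul2l (_ : 0 < 4 * B4)); last by lia.
  by apply: (@leq_trans (n * n)); lia.
have K2 : 2 <= K.
  rewrite ltnNge; apply/negP => K1; have := leq_mul (leqnn (20 * B2)) K1.
  by clear -Ku lB3 lB4 lB2 lenB; lia.
exists g, K, mu, ka, s; split.
- split; first by lia.
  + apply: leq_trans _ Kl; rewrite leq_mul2r; lia.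
  + apply: leq_trans _ ml; rewrite leq_mul2r; lia.
  + apply: leq_trans _ kl; rewrite leq_mul2r; lia.
- lia.
- suff : net_gain (n ^ 3) 0 I s by rewrite /net_gain expn0 muln1.
  apply: gE.
  + lia.
  + by apply: leq_trans _ leI; rewrite leq_mul2r leq_addr orbT.
  + by rewrite muln1; apply: leq_trans nE nn3.
- split; last by apply: leq_trans _ sl; rewrite leq_mul2r /D; lia.
  have K1 : n <= 80 * B2 * K.-1 by lia.
  have g1 : n * n <= 8 * B4 * (g - (3 * n + 2)) by rewrite mulnBr; lia.
  have := leq_mul K1 g1; rewrite mulnACA -n3 => le1.
  rewrite -(@leq_pmul2l D); last by lia.
  apply: leq_trans sl (leq_trans le1 _); rewrite leq_mul2r /D; lia.
move=> x0 y0 y1 hx0 hy0 hy1 hxn.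
have [t1' t1'l t1'u] := @floor_div (n * n) (4 * A1) ltac:(lia).
have [t2' t2'l t2'u] := @floor_div (n * n) (4 * A2) ltac:(lia).
have [t1 t1l t1u] := @floor_div (n * n) (8 * B2) ltac:(lia).
have [t2 t2l t2u] := @floor_div (n * n) (4 * B3) ltac:(lia).
have [z' z'l z'u] := @floor_div (n * n) A3 ltac:(lia).
have [z zl zu] := @floor_div (n * n) B4 ltac:(lia).
have [gn gnl gnu] := @floor_div (n * n) 16 isT.
have [gk gkl gku] := @floor_div (ka * n) 4 isT.
have mA1 : 1000 * (A1 * n) <= n * n by apply: mono; lia.
have mA2 : 1000 * (A2 * n) <= n * n by apply: mono; lia.
have mA3 : 1000 * (A3 * n) <= n * n by apply: mono; lia.
have mB1 : 1000 * (B1 * n) <= n * n by apply: mono; lia.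
have mB2 : 1000 * (B2 * n) <= n * n by apply: mono; lia.
have mB3 : 1000 * (B3 * n) <= n * n by apply: mono; lia.
have gain_le a : a <= B4 -> a * g.+1 <= n * n.
  move=> le; apply: (@leq_trans (B4 * g.+1)); first by rewrite leq_mul2r le orbT.
  by clear -gl b4n nn; lia.
have TB2 : 4 * (B2 * (t1 + n)) <= n * n by clear -t1l mB2; lia.
have TB1 : 2560 * (B1 * (t1 + n)) <= B2 * (t1 + n).
  by rewrite mulnA leq_mul2r; clear -lB2 B1B2; lia.
have TA3 : 576 * (A3 * (t1 + n)) <= B1 * (t1 + n).
  by rewrite mulnA leq_mul2r; clear -lB1; lia.
have TA1 : 320 * (A1 * (t1 + n)) <= A3 * (t1 + n).
  by rewrite mulnA leq_mul2r; clear -lA3 lA2; lia.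
have KB2 : 20 * (B2 * (K * n)) <= n * n.
  by rewrite !mulnA leq_mul2r Kl orbT.
have KB1 : B1 * (K * n) <= B2 * (K * n).
  by rewrite leq_mul2r; clear -lB2 B1B2; lia.
have KA3 : A3 * (K * n) <= B1 * (K * n).
  by rewrite leq_mul2r; clear -lB1; lia.
have kk : 4 * (A3 * (ka * ka)) <= n * n.
  have := leq_mul kl kl; have : A3 * (ka * ka) <= A3 * (A3 * (ka * ka)).
    by rewrite leq_pmull //; clear -lA3 lA2 lA1; lia.
  by clear; lia.
have mun : 4 * (B1 * (n * mu)) <= n * n.
  by have := leq_mul (leqnn n) ml; clear; lia.
have x0n : n <= 2 * x0.-1 by clear -hx0 lenB B4_gt0; lia.
have big_n : 1000 * n <= n * n by rewrite leq_mul2r; clear -lenB B4_gt0; lia.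
have n80 : 80 <= n by clear -lenB B4_gt0; lia.
have gk_large : n * n <= 9 * A3 * gk.
  have : n * n <= (2 * A3 * ka + 2 * A3) * n by rewrite leq_mul2r ltnW ?orbT.
  have := leq_mul (leqnn (2 * A3)) (ltnW gku).
  have : A3 <= A3 * n by rewrite leq_pmulr.
  by clear -mA3; lia.
have gn_large : n * n <= 20 * gn by clear -gnu big_n n80; lia.
have t1_large : n * n <= 9 * B2 * t1.
  have : B2 <= B2 * n by rewrite leq_pmulr.
  by clear -t1u mB2; lia.
have z'A : 320 * (A2 * z') <= A3 * z' by rewrite mulnA leq_mul2r lA3 orbT.
have z'A1 : 320 * (A1 * z') <= A2 * z' by rewrite mulnA leq_mul2r lA2 orbT.
have zB3 : 320 * (B3 * z) <= B4 * z by rewrite mulnA leq_mul2r lB4 orbT.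
constructor.
(* Taking [th_h] equal to K makes both terms on the left of [th_small] equal to K * n. *)
apply: (@Thresholds _ _ _ _ _ _ _ _ _ z t1 t2 z' t1' t2' K gn gk gk gn).
all: rewrite -?mulnn.
- rewrite lt0n; apply/eqP => z0; move: zu; rewrite z0 muln0.
  by clear -nn b4n; lia.
- rewrite -(@leq_pmul2l (80 * (B2 * B4))); last by clear -B24; lia.
  have := leq_mul halfK (_ : n * n <= 2 * (B4 * z)) => /(_ ltac:(clear -zu nn b4n; lia)).
  by move: leI; rewrite n3; clear; lia.
- rewrite -(@ltn_pmul2l (8 * B2)); last by clear -lB2 B1B2 lB1 lA3 lA2 lA1; lia.
  by clear -KB2 t1u mB2 n_gt0; have := leq_pmulr B2 n_gt0; lia.
- rewrite -ltnS -(@ltn_pmul2l A3); last by clear -lA3 lA2 lA1; lia.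
  by clear -TA3 TB1 TB2 z'u nn_gt0; lia.
- rewrite -ltnS -(@ltn_pmul2l A3); last by clear -lA3 lA2 lA1; lia.
  by clear -TA3 TB1 TB2 z'u nn_gt0 KB2 KB1 KA3 kk; lia.
- rewrite -(leq_pmul2l (ltn0Sn 1)) mulnDr !bin2_double.
  have y1P : y1 * y1.-1 <= y1 * y1 by rewrite leq_mul2l leq_pred orbT.
  have x0P : x0 * x0.-1 + x0 = x0 * x0.
    by rewrite -mulnSr prednK //; clear -x0n n_gt0; lia.
  have := leq_mul hy1 hy1; have := leq_mul hx0 hx0.
  by clear -y1P x0P gnl big_n hxn; lia.
- by have := leq_mul (leqnn ka) x0n; clear -gkl; lia.
- have le1 : n + 2 * y1 <= 4 * x0.-1 by clear -hx0 hy1 n80; lia.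
  by have := leq_mul (leqnn ka) le1; clear -gkl; lia.
- by clear -hx0 hy1 n80; lia.
- rewrite -(leq_pmul2l (ltn0Sn 1)) bin2_double.
  have x0P : x0 * x0.-1 + x0 = x0 * x0.
    by rewrite -mulnSr prednK //; clear -x0n n_gt0; lia.
  have := leq_mul hx0 hx0.
  by clear -x0P gnl big_n hxn; lia.
- by have := leq_mul x0n hy0; clear -gnl; lia.
- apply: gB3 => //.
  + by clear -zB3 zl t2l mB3; lia.
  + by apply: gain_le; clear -lB4; lia.
- apply: gB4 => //; last exact: gain_le.
  have : B3 <= B3 * n by rewrite leq_pmulr.
  by clear -t2u mB3; lia.
- apply: gA1 => //; last by apply: gain_le; lia.
  by clear -TA1 TA3 TB1 TB2; lia.
- apply: gB1 => //; last by apply: gain_le; lia.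
  by clear -TB1 TB2 mun; lia.
- apply: gB2; last by apply: gain_le; lia.
  + have m1 : 9 * n <= 40 * (B1 * mu) by clear -mm lenB lB4 lB3 lB2 B1B2; lia.
    have m2 : 9 * n <= 40 * (B1 * mu.-1).
      have -> : B1 * mu.-1 = B1 * mu - B1 by clear; case: mu => [|k]; lia.
      by clear -mm lenB lB4 lB3 lB2 B1B2; lia.
    have := leq_mul m1 m2; have := bin2_double mu => E2.
    have -> : 40 * (B1 * mu) * (40 * (B1 * mu.-1)) = 1600 * (B1 * B1 * (mu * mu.-1)) by lia.
    by rewrite -E2; clear; lia.
  + by clear -TB2; lia.
- apply: gB1 => //; last by apply: gain_le; lia.
  by clear -TB1 TB2 mun KB1 KB2; lia.
- apply: gA1 => //; last by apply: gain_le; lia.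
  by clear -t1'l mA1 z'A z'A1 z'l; lia.
- apply: gA2; last by apply: gain_le; lia.
  + have : A1 <= A1 * n by rewrite leq_pmulr.
    by clear -t1'u mA1; lia.
  by clear -t2'l mA2 z'A z'l; lia.
apply: gA3 => //; last by apply: gain_le; lia.
have : A2 <= A2 * n by rewrite leq_pmulr.
by clear -t2'u mA2; lia.
Qed.

(** * Summing over the partitions *)

Section Assembly.

Variable V : finType.
Implicit Types (H : {set {set V}}) (X S p e U : {set V}) (a b c u v w x y : V).

Local Notation n := #|V|.

Definition Forb_nat (I : nat) : {set {set {set V}}} :=
  [set H : {set {set V}} |
    [&& is_3graph H, ~~ has_copy T5 H & min_inconsistent H <= I]].

Definition semi_bipartites : {set {set {set V}}} :=
  [set H : {set {set V}} | is_3graph H && semi_bipartite H].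

Lemma partitionC X : ordered_partition (X, ~: X).
Proof. by rewrite /ordered_partition /= setUCr eqxx -setI_eq0 setICr eqxx. Qed.

Lemma inconsistent_edgesE H X : inconsistent_edges H (X, ~: X) = inconsistent X H.
Proof. by []. Qed.

Lemma is_3graph_triples H : is_3graph H -> H \subset triples [set: V].
Proof.
by move=> /forall_inP H3; apply/subsetP => e /H3 e3; rewrite inE subsetT.
Qed.

(* Moving [v] to the other side changes the status of the edges through [v] only. *)
Lemma optimal_move H X X' v : is_3graph H -> X' :\ v = X :\ v -> (v \in X') = (v \notin X) ->
  #|inconsistent X H| <= #|inconsistent X' H| ->
  if v \in X then #|ltype X H v 2| <= #|ltype X H v 1|
  else #|ltype X H v 1| <= #|ltype X H v 2|.
Proof.
move=> H3 XX' vX'; rewrite (card_delv_link _ v) [leqRHS](card_delv_link _ v).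
have IX e : v \notin e -> e :&: X' = e :&: X.
  move=> ve; apply/setP => u; have /setP/(_ u) := XX'; rewrite !inE.
  by case: eqP => [->|_ /= ->] //; rewrite (negPf ve).
have -> : delv (inconsistent X H) v = delv (inconsistent X' H) v.
  apply/setP => e; rewrite !inE; case: (boolP (v \in e)) => ve; rewrite ?andbF //.
  by rewrite IX.
rewrite leq_add2l.
have linkE Y : (forall p, v \notin p -> p :&: Y = p :&: X) ->
    link (inconsistent Y H) v = link H v :\: ltype X H v (ctype Y v).
  move=> YX; apply/setP => p; rewrite !inE; case: (boolP (v \in p)) => //= vp.
  rewrite card_setU1I // YX // /ctype; case: (_ \in H); rewrite ?andbF ?andbT //=.
  by case: (v \in Y).
rewrite (linkE X) // (linkE X') // !cardsDS; first last.
- by apply/subsetP => p; rewrite inE => /andP[].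
- by apply/subsetP => p; rewrite inE => /andP[].
have sub j : #|ltype X H v j| <= #|link H v|.
  by apply: subset_leq_card; apply/subsetP => p; rewrite inE => /andP[].
rewrite /ctype vX'; have := sub 1; have := sub 2.
by case: (v \in X) => /=; lia.
Qed.

Lemma Forb_not_semi_bipartite H I : H \in Forb_nat I -> ~~ semi_bipartite H ->
  exists2 X, H \in T5_family X I [set: V] & inconsistent X H != set0.
Proof.
rewrite inE => /and3P[H3 T5H]; rewrite /min_inconsistent.
case: arg_minnP => [|[X Y] /= part minP leI].
  by rewrite /ordered_partition /= setU0 eqxx disjoint_sym -setI_eq0 set0I eqxx.
have YE : Y = ~: X.
  move: part => /andP[/= /eqP XY dis]; apply/setP => y; have /setP/(_ y) := XY.
  rewrite !inE; case: (boolP (y \in X)) => /= [yX _|_ ->//].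
  by apply/negbTE/negP => yY; move/pred0P: dis => /(_ y); rewrite /= yX yY.
rewrite YE inconsistent_edgesE in leI minP => nSB; exists X.
  rewrite inE is_3graph_triples // T5H leI; apply/forallP => v.
  pose X' := if v \in X then X :\ v else v |: X.
  have := @optimal_move H X X' v H3; rewrite cardsT subnn mul0n !addn0; apply.
  - rewrite /X'; case: ifP => vX; apply/setP => u; rewrite !inE; by case: eqP.
  - by rewrite /X'; case: ifP => vX; rewrite !inE eqxx.
  exact: (minP (X', ~: X') (partitionC X')).
apply: contra nSB => /eqP/setP I0; apply/existsP; exists (X, ~: X).
rewrite partitionC; apply/forall_inP => e eH; have := I0 e.
by rewrite !inE eH => /negbFE.
Qed.

Lemma exp_ctriples_leq X : 2 ^ #|ctriples X [set: V]| <= #|semi_bipartites|.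
Proof.
rewrite -card_powerset; apply: subset_leq_card; apply/subsetP => H.
rewrite inE => /subsetP sH; rewrite inE; apply/andP; split.
  by apply/forall_inP => e /sH; rewrite !inE => /andP[/andP[]].
apply/existsP; exists (X, ~: X); rewrite partitionC; apply/forall_inP => e /sH.
by rewrite !inE => /andP[].
Qed.

Lemma card_ctriplesT X : #|ctriples X [set: V]| = 'C(#|X|, 2) * #|~: X|.
Proof.
have E2 : #|[set A : {set V} | A \subset X & #|A| == 2]| = 'C(#|X|, 2) by rewrite cards_draws.
have E1 : #|[set A : {set V} | A \subset ~: X & #|A| == 1]| = #|~: X|.
  by rewrite cards_draws bin1.
rewrite -E1 -E2 -cardsX; pose f e := (e :&: X, e :&: ~: X).
have -> : setX [set A : {set V} | A \subset X & #|A| == 2]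
  [set A : {set V} | A \subset ~: X & #|A| == 1] = [set f e | e in ctriples X [set: V]].
  apply/setP => -[A B]; rewrite !inE /=; apply/idP/imsetP.
    case/andP=> /andP[AX A2] /andP[BX B1]; exists (A :|: B).
      have AB : A :&: B = set0.
        by apply/eqP; rewrite setI_eq0 (disjointWl AX) // disjoint_sym disjoints_subset.
      have BX0 : B :&: X = set0.
        by apply/eqP; rewrite setI_eq0 disjoints_subset.
      rewrite !inE subsetT cardsU AB cards0 (eqP A2) (eqP B1) /=.
      by rewrite setIUl BX0 setU0 (setIidPl AX).
    rewrite /f !setIUl (setIidPl AX) (setIidPl BX).
    have -> : B :&: X = set0 by apply/eqP; rewrite setI_eq0 disjoints_subset.
    have -> : A :&: ~: X = set0 by apply/eqP; rewrite setI_eq0 disjoints_subset setCK.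
    by rewrite set0U setU0.
  case=> e; rewrite !inE => /andP[/andP[_ /eqP e3] /eqP e2] [-> ->].
  have c1 : #|e :\: X| = 1 by have := cardsID X e; rewrite e2 e3; lia.
  by rewrite setDE in c1; rewrite !subsetIr e2 c1.
rewrite card_imset // => e1 e2 [h1 h2].
by rewrite -(setIT e1) -(setIT e2) -(setUCr X) !setIUr h1 h2.
Qed.

Lemma exists_card k : k <= n -> exists X, #|X| = k.
Proof.
move=> le; have : 0 < #|[set A : {set V} | #|A| == k]| by rewrite card_draws bin_gt0.
by case/card_gt0P => X; rewrite inE => /eqP; exists X.
Qed.

End Assembly.

(* With D = |x - 2y|; x^2 y is maximal, for x + y fixed, when x = 2y. *)
Lemma abs_diff_identity x y : exists2 D, (x = 2 * y + D \/ 2 * y = x + D) &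
  27 * (x * x * y) + D * D * (4 * x + y) = 4 * (x + y) ^ 3.
Proof.
have id D : D * D + 4 * (x * y) = x * x + 4 * (y * y) ->
    27 * (x * x * y) + D * D * (4 * x + y) = 4 * (x + y) ^ 3.
  move=> /(congr1 (fun z => z * (4 * x + y))); rewrite !expnS expn0; lia.
case: (leqP (2 * y) x) => le.
  have [D xE] : exists D, x = 2 * y + D by exists (x - 2 * y); lia.
  by exists D; [left | apply: id; rewrite xE; lia].
have [D yE] : exists D, 2 * y = x + D by exists (2 * y - x); lia.
exists D; [by right | apply: id].
have := congr1 (fun z => z * z) yE; have := congr1 (fun z => x * z) yE; rewrite /=; lia.
Qed.

(** By the identity, D > n / 12 costs at least n^3 / 144 in 27 x^2 y, hence n^3 / 7776 in x^2 y / 2.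
    This exceeds s <= n^3 / 10000 by a cubic margin, which for n >= 10^6 also covers q and the
    quadratic loss from rounding 2n/3. *)
Lemma unbalanced_deficit n x y D s q x1 y1 :
  x + y = n -> x1 + y1 = n -> (x = 2 * y + D \/ 2 * y = x + D) -> n < 12 * D ->
  27 * (x * x * y) + D * D * (4 * x + y) = 4 * n ^ 3 ->
  3 * x1 <= 2 * n -> 2 * n < 3 * x1 + 3 ->
  100 * 100 * s <= n ^ 3 -> q <= 3 * n -> 100 * 100 * 100 <= n ->
  'C(x, 2) * y + s + q <= 'C(x1, 2) * y1.
Proof.
move=> xy xy1 _ ltD E lex1 gtx1 les leq_q len.
have n3 : n ^ 3 = n * n * n by rewrite !expnS expn0 muln1 mulnA.
have h1 : n * n * n <= 144 * (D * D * (4 * x + y)).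
  have : n * n <= 12 * D * (12 * D) by apply: leq_mul; apply: ltnW.
  move/leq_mul/(_ (_ : n <= 4 * x + y)) => /(_ ltac:(lia)); lia.
have h2 : 2 * ('C(x, 2) * y) <= x * x * y.
  by rewrite mulnA bin2_double leq_mul2r leq_mul2l leq_pred !orbT.
have h3 : (2 * n - 5) * (2 * n - 2) * n <= 54 * ('C(x1, 2) * y1).
  have -> : 54 * ('C(x1, 2) * y1) = 3 * x1.-1 * (3 * x1) * (3 * y1).
    have := bin2_double x1 => /(congr1 (fun z => 27 * z * y1)); lia.
  by apply: leq_mul; [apply: leq_mul|]; lia.
have h4 : 4 * (n * n * n) <= (2 * n - 5) * (2 * n - 2) * n + 14 * (n * n).
  have [m ->] : exists m, n = m + 5 by exists (n - 5); lia.
  have -> : 2 * (m + 5) - 5 = 2 * m + 5 by lia.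
  have -> : 2 * (m + 5) - 2 = 2 * m + 8 by lia.
  lia.
have h5 : 100 * 100 * 100 * (n * n) <= n * n * n by rewrite [leqRHS]mulnC leq_mul2r len orbT.
have h6 : n <= n * n by rewrite leq_pmulr //; lia.
rewrite n3 in les E; lia.
Qed.

Lemma card_not_semi_bipartite : exists c n0 : nat, forall (V : finType) I,
  n0 <= #|V| -> c * I <= #|V| ^ 3 ->
  #|[set H in Forb_nat V I | ~~ semi_bipartite H]| * 2 ^ (#|V| %/ 10).+1
    <= #|semi_bipartites V|.
Proof.
have [c [n0 params]] := parameters; exists c, (n0 + 100 * 100 * 100) => V I len leI.
set n := #|V| in len leI *.
have [g [K [mu [ka [s [[K0 leK lemu leka] leg leS [lesK les] th]]]]]] :=
  params n I ltac:(lia) leI.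
(* n for the sum over the partitions, n %/ 10 + 1 for the claimed saving, and 1 for the factor 2 in
   [key]. *)
pose q := n + n %/ 10 + 2; pose S := #|semi_bipartites V|.
have q10 : 10 * (n %/ 10) <= n by rewrite mulnC leq_divM.
have key X : #|[set H in T5_family X I [set: V] | inconsistent X H != set0]| * 2 ^ q <= 2 * S.
  pose x := #|X|; pose y := #|~: X|; have xy : x + y = n by rewrite /x /y cardsC.
  have [D Dxy E] := abs_diff_identity x y; rewrite xy in E.
  (* In the first case |X| is within n / 36 of 2n / 3; with K <= n / 100 this implies the bounds 62,
     29 and 37 in [parameters]. *)
  case: (leqP (12 * D) n) => leD.
    have [th0] := th (x - K) (y - K) y ltac:(lia) ltac:(lia) ltac:(lia) ltac:(lia).
    apply: leq_trans (_ : 2 * 2 ^ #|ctriples X [set: V]| <= _); last first.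
      by rewrite leq_mul2l exp_ctriples_leq.
    (* 2d is about 1.12 n, enough for q, about 1.1 n, and for the factor n^2 + 1 <= 2^(l + 1); yet l
       + d plus the small losses stays below 0.62 n. *)
    pose l := 2 * (n %/ 400) + 18; pose d := 14 * (n %/ 25).
    have l400 : 400 * (n %/ 400) <= n by rewrite mulnC leq_divM.
    have d25 : 25 * (n %/ 25) <= n < 25 * (n %/ 25) + 25.
      by rewrite mulnC leq_divM addnC -mulSn ltn_ceil.
    have r128 : 128 * (n %/ 2 ^ 7) <= n by rewrite mulnC leq_divM.
    have lel : n ^ 2 <= 2 ^ l := sqr_leq_exp n.
    have le1 : (n ^ 2).+1 <= 2 ^ l.+1.
      by rewrite (expnS 2 l) mul2n -addnn -addn1 leq_add // expn_gt0.
    apply: (@card_T5_family_inconsistent V X I g K (x - K) (y - K) y mu ka th0 _ _ _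
      7 (7 * mu + 2 * (n %/ 2 ^ 7) + 4) l d _ _ _ _ (g - (3 * n + 2)) s) => //.
    - by rewrite subnK //; lia.
    - by rewrite subnK //; lia.
    - rewrite /l /d; lia.
    - have n2 : n ^ 2 <= 2 ^ n * 2 ^ n by rewrite -mulnn leq_mul // ltnW // ltn_expl.
      have n1 : n <= 2 ^ n by rewrite ltnW // ltn_expl.
      have : n * (3 * 2 ^ n + n ^ 2) <= 2 ^ (3 * n + 2).
        have -> : 2 ^ (3 * n + 2) = 2 ^ n * (4 * (2 ^ n * 2 ^ n)).
          by rewrite expnD mulSn expnD mul2n -addnn expnD; lia.
        apply: leq_mul => //; have p : 0 < 2 ^ n by rewrite expn_gt0.
        have : 2 ^ n <= 2 ^ n * 2 ^ n by rewrite leq_pmulr.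
        by move: n2; clear; lia.
      move=> le2; apply: leq_trans (leq_mul le2 (leqnn _)) _.
      by rewrite -expnD subnKC //; lia.
    - by lia.
    - by apply: leq_trans le1 _; rewrite leq_exp2l // /l /d; lia.
    - by rewrite /q; lia.
    apply: leq_trans (leq_mul le1 (leqnn _)) _.
    by rewrite -expnD leq_exp2l // /l /d /q; lia.
  pose x1 := (2 * n) %/ 3.
  have x1l : 3 * x1 <= 2 * n by rewrite mulnC leq_divM.
  have x1u : 2 * n < 3 * x1 + 3 by rewrite addnC -mulnS [ltnRHS]mulnC ltn_ceil.
  have [X1 X1E] := @exists_card V x1 ltac:(lia).
  have X1C : x1 + #|~: X1| = n by rewrite -X1E cardsC.
  have deficit := @unbalanced_deficit n x y D s q x1 _ xy X1C Dxy leD E x1l x1u les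
    ltac:(rewrite /q; lia) ltac:(lia).
  apply: leq_trans (_ : #|T5_family X I [set: V]| * 2 ^ q <= _).
    rewrite leq_mul2r; apply/orP; right; apply: subset_leq_card.
    by apply/subsetP => H; rewrite inE => /andP[].
  apply: leq_trans (leq_mul (card_T5_family_crude X I [set: V]) (leqnn _)) _.
  apply: leq_trans (leq_mul (leq_mul leS (leqnn _)) (leqnn _)) _.
  rewrite -!expnD card_ctriplesT.
  apply: leq_trans (_ : 2 ^ #|ctriples X1 [set: V]| <= _).
    rewrite card_ctriplesT X1E leq_exp2l //; move: deficit; rewrite -/x -/y; lia.
  by apply: leq_trans (exp_ctriples_leq X1) _; rewrite -/S mul2n -addnn leq_addr.
rewrite -(@leq_pmul2r (2 ^ n.+1)) ?expn_gt0 // -mulnA -expnD.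
have -> : (n %/ 10).+1 + n.+1 = q by rewrite /q; lia.
apply: leq_trans (_ : (\sum_(X : {set V})
  #|[set H in T5_family X I [set: V] | inconsistent X H != set0]|) * 2 ^ q <= _).
  rewrite leq_mul2r; apply/orP; right; apply: leq_trans (leq_card_bigcup _ _).
  apply: subset_leq_card; apply/subsetP => H; rewrite inE => /andP[HF nSB].
  have [X HX I0] := Forb_not_semi_bipartite HF nSB.
  by apply/bigcupP; exists X; rewrite // inE HX.
rewrite big_distrl /=; apply: leq_trans (leq_sum _ (fun X _ => key X)) _.
rewrite sum_nat_const (_ : #|_| = 2 ^ n) ?expnS -/S; first by lia.
by have := card_powerset [set: V]; rewrite powersetT !cardsT.
Qed.

(** * Absorbing small n into the constant and passing to the reals *)

Lemma card_Forb_nat_ltn : exists c M : nat, forall n I, c * I <= n ^ 3 ->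
  #|Forb_nat 'I_n I| * 2 ^ (n %/ 10).+1 < (2 ^ (n %/ 10).+1 + M) * num_semi_bipartite n.
Proof.
have [c [n0 main]] := card_not_semi_bipartite.
(* The product covers n <= n0, where all sets of subsets are counted and the semi-bipartite count is
   at least 1; the 2 yields strictness. *)
exists c, (2 ^ 2 ^ n0 * 2 ^ n0.+1 + 2) => n I leI.
have := main 'I_n I; rewrite card_ord -[num_semi_bipartite n]/#|semi_bipartites 'I_n|.
set S := #|semi_bipartites _|; set k := (n %/ 10).+1 => {}main.
have S0 : 0 < S by apply: leq_trans (exp_ctriples_leq set0); rewrite expn_gt0.
have k0 : 0 < 2 ^ k by rewrite expn_gt0.
case: (leqP n0 n) => [le|/ltnW lt].
  have {main} := main le leI; set B := [set H in _ | _] => leB.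
  have leF : #|Forb_nat 'I_n I| <= S + #|B|.
    apply: leq_trans (leq_card_setU _ _); apply: subset_leq_card; apply/subsetP => H HF.
    rewrite in_setU [H \in B]inE HF /= inE; case: (semi_bipartite H); rewrite ?orbT //.
    by rewrite andbT; move: HF; rewrite inE => /and3P[->].
  apply: leq_ltn_trans (leq_mul leF (leqnn _)) _.
  rewrite mulnDl [S * _]mulnC (mulnDl (2 ^ k)) ltn_add2l.
  apply: leq_ltn_trans leB _; rewrite mulnDl mul2n -addnn addnA addnC -[X in X < _]addn0.
  by rewrite ltn_add2l addn_gt0 S0 orbT.
have leF : #|Forb_nat 'I_n I| <= 2 ^ 2 ^ n.
  apply: leq_trans (max_card _) _.
  have := card_powerset [set: {set 'I_n}]; rewrite powersetT !cardsT => ->.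
  by have := card_powerset [set: 'I_n]; rewrite powersetT !cardsT card_ord => ->.
have le1 : #|Forb_nat 'I_n I| * 2 ^ k <= 2 ^ 2 ^ n0 * 2 ^ n0.+1.
  apply: leq_mul; first by apply: leq_trans leF _; rewrite !leq_exp2l.
  by rewrite leq_exp2l // /k ltnS (leq_trans (leq_div _ _)).
apply: leq_ltn_trans le1 _; set M := _ * _.
by apply: leq_trans (leq_pmulr _ S0); lia.
Qed.

Import Order.TTheory GRing.Theory Num.Theory.

Local Open Scope ring_scope.

Theorem theorem3 (R : realType) :
  exists2 eta0 : R, 0 < eta0 &
    forall eta : R, 0 < eta -> eta < eta0 ->
      exists C' : R, forall n : nat, (0 < n)%N ->
        #|Forb_T5 n eta|%:R < (1 + C' * 2 `^ (- (n%:R / 10))) *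
          (num_semi_bipartite n)%:R.
Proof.
have [c [M main]] := card_Forb_nat_ltn.
exists (c.+1%:R^-1); first by rewrite invr_gt0 ltr0n.
move=> eta eta_gt0 lt_eta; exists M%:R => n n_gt0.
(* The successor makes k exceed the real number n / 10, so that 2^(-k) is at most 2^(-n/10). *)
pose I := (n ^ 3 %/ c.+1)%N; pose k := (n %/ 10).+1.
have leI : (c * I <= n ^ 3)%N.
  by apply: leq_trans (leq_divM (n ^ 3) c.+1); rewrite mulnC leq_mul2l leqnSn orbT.
have sub : (#|Forb_T5 n eta| <= #|Forb_nat 'I_n I|)%N.
  apply: subset_leq_card; apply/subsetP => H; rewrite !inE => /and3P[-> -> le].
  rewrite /I leq_divRL // -(ler_nat R) natrM -ler_pdivlMr ?ltr0n //.
  apply: le_trans le _; rewrite natrX mulrC ler_wpM2l ?exprn_ge0 ?ler0n //.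
  exact: ltW.
have lt_nat := leq_ltn_trans (leq_mul sub (leqnn (2 ^ k))) (main n I leI).
have k_gt0 : 0 < 2 ^+ k :> R by rewrite exprn_gt0.
have le_pow : (2 ^+ k)^-1 <= 2 `^ (- (n%:R / 10)) :> R.
  rewrite -powR_mulrn // -powRN ler_powR ?ler1n // lerN2.
  rewrite ler_pdivrMr // -natrM ler_nat ltnW // ltn_ceil //.
apply: lt_le_trans (_ : (1 + M%:R * (2 ^+ k)^-1) * (num_semi_bipartite n)%:R <= _).
  rewrite -(ltr_pM2r k_gt0) mulrAC mulrDl mul1r divfK ?gt_eqF //.
  by move: lt_nat; rewrite -(ltr_nat R) !(natrM, natrD) natrX.
by rewrite ler_wpM2r ?ler0n // lerD2l ler_wpM2l ?ler0n.
Qed.
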